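(* Let $R$ be a regular local ring of dimension $2$ with fraction field $\operatorname{QF}(R)$. Every nonzero $z\in \operatorname{QF}(R)$ has only finitely many dicritical divisors in $R$, and the number of these dicritical divisors is zero if and only if $z\in R$ or $1/z\in R$.
   Context: Let $R$ be a regular local ring of dimension $2$, with maximal ideal $\mathfrak m$ and residue field $K=R/\mathfrak m$. A prime divisor of $R$ is a discrete valuation ring $V$ with fraction field $\operatorname{QF}(R)$ that dominates $R$ (i.e. $R\subseteq V$ and $\mathfrak m_v\cap R=\mathfrak m$, where $\mathfrak m_v$ is the maximal ideal of $V$) and whose residue field $K_v=V/\mathfrak m_v$ is transcendental over $K$. Write $H_v:V\to K_v$ for the canonical projection; $K$ is identified with $H_v(R)\subseteq K_v$. For $z\in\operatorname{QF}(R)$, $z\neq 0$, a dicritical divisor of $z$ in $R$ is a prime divisor $V$ of $R$ such that $z\in V$ and $H_v(z)$ is transcendental over $K$. *)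

(* Defs.v *)
From HB Require Import structures.
From mathcomp Require Import all_boot all_order all_algebra.
From mathcomp Require Import boolp classical_sets cardinality.

Set Implicit Arguments.
Unset Strict Implicit.
Unset Printing Implicit Defensive.

Import GRing.Theory.
Local Open Scope classical_set_scope.
Local Open Scope ring_scope.
Local Open Scope quotient_scope.

Notation "x %:F" := (FracField.tofrac x) : ring_scope.

(* Subsets of a ring (ideals, subrings) are boolean predicates, as in MathComp;
   with the classical axioms of [boolp] these are arbitrary subsets.
   MathComp's [idealr_closed] and [idealr] describe *proper* ideals. *)

Section Ideals.
Variable A : comNzRingType.
Implicit Types (I M P : {pred A}) (s : seq A).

Definition generates s I : Prop :=
  forall x, x \in I <->
    exists c : 'I_(size s) -> A, x = \sum_(i < size s) c i * s`_i.

(* Restricting to proper ideals is harmless: the unit ideal is generated by 1. *)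
Definition noetherian : Prop :=
  forall I, idealr_closed I -> exists s, generates s I.

Definition principal_ideal_ring : Prop :=
  forall I, idealr_closed I -> exists a, generates [:: a] I.

Definition prime_ideal P : Prop := idealr_closed P /\ prime_idealr_closed P.

Definition maximal_ideal M : Prop :=
  idealr_closed M /\
  forall I, idealr_closed I -> {subset M <= I} -> I =i M.

Definition local_ring M : Prop :=
  maximal_ideal M /\ forall N : {pred A}, maximal_ideal N -> N =i M.

Definition prime_chain (n : nat) (P : 'I_n.+1 -> {pred A}) : Prop :=
  (forall i, prime_ideal (P i)) /\
  (forall i j : 'I_n.+1, (i < j)%N ->
     {subset P i <= P j} /\ ~ {subset P j <= P i}).

Definition has_krull_dim (d : nat) : Prop :=
  (exists P : 'I_d.+1 -> {pred A}, prime_chain P) /\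
  (forall n (P : 'I_n.+1 -> {pred A}), prime_chain P -> (n <= d)%N).

Definition regular_local_ring M (d : nat) : Prop :=
  [/\ noetherian, local_ring M, has_krull_dim d
    & exists2 s, size s = d & generates s M].

Definition discrete_valuation_ring M : Prop :=
  [/\ GRing.integral_domain_axiom A, principal_ideal_ring, local_ring M
    & exists2 t, t \in M & t != 0].

End Ideals.

Section SubringType.
Variable F : fieldType.

Definition subring_type (V : subringClosed F) := {x : F | x \in V}.

HB.instance Definition _ V := SubChoice.on (subring_type V).
HB.instance Definition _ V :=
  [SubChoice_isSubComNzRing of subring_type V by <:].

(* Bundled subrings are determined by their underlying subsets, so counting
   them is counting subsets of F. *)
Lemma subringClosed_ext (V W : subringClosed F) : V =i W -> V = W.
Proof.
case: V => V [[cV1] [cV2] [cV3] [cV4]]; case: W => W [[cW1] [cW2] [cW3] [cW4]].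
move=> /= VW; have {}VW : V = W by apply: funext => x; exact: VW.
subst W; congr (GRing.SubringClosed.Pack (GRing.SubringClosed.Class _ _ _ _));
  congr (_ _); exact: Prop_irrelevance.
Qed.

End SubringType.

(* [K] is meant to be a subfield of the field [L]. *)
Definition algebraic_over (L : nzRingType) (K : set L) (u : L) : Prop :=
  exists p : {poly L}, [/\ forall i, K p`_i, p != 0 & root p u].

Definition transcendental_over (L : nzRingType) (K : set L) (u : L) : Prop :=
  ~ algebraic_over K u.

Section PrimeDivisors.
Variables (R : idomainType) (m : idealr R).
Notation QF := {fraction R}.
Implicit Types V : subringClosed QF.

Definition dominates V (mv : idealr (subring_type V)) : Prop :=
  (forall r : R, r%:F \in V) /\
  (forall r : R, r \in m <-> exists2 v, v \in mv & val v = r%:F).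

Definition has_fraction_field_QF V : Prop :=
  forall x : QF, exists a b : subring_type V, val b != 0 /\ x = val a / val b.

(* The canonical projection onto the residue field V / mv. *)
Definition Hv V (mv : idealr (subring_type V)) (v : subring_type V) :
  {ideal_quot mv} := \pi v.

(* The image of R in V / mv, with which the residue field of R is identified
   as soon as V dominates R. *)
Definition residue_image V (mv : idealr (subring_type V)) :
  set {ideal_quot mv} :=
  [set Hv mv v | v in [set w | exists r : R, val w = r%:F]].
Arguments residue_image {V} mv _.

Definition prime_divisor V (mv : idealr (subring_type V)) : Prop :=
  [/\ discrete_valuation_ring mv, has_fraction_field_QF V, dominates mv
    & exists u : {ideal_quot mv}, transcendental_over (residue_image mv) u].

Definition dicritical_divisor (z : QF) V : Prop :=
  exists mv : idealr (subring_type V),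
    prime_divisor mv /\
    exists2 v : subring_type V, val v = z
      & transcendental_over (residue_image mv) (Hv mv v).

Definition dicritical_divisors (z : QF) : set (subringClosed QF) :=
  [set V | dicritical_divisor z V].

End PrimeDivisors.

Arguments residue_image {R V} mv _.

(* Main.v *)
(* Write z = a/b with x^c and y^c in (a, b), where m = (x, y), and suppose that a and b are
   in m. Let S be the localization of R[z] at mR[z]: it is a local domain, S[1/b] = QF(R),
   and S/bS has finite length L. The dicritical divisors of z are the discrete valuation
   rings of QF(R) above S in which b is not invertible. By the theorem of Krull and Akizuki,
   T/bT has length at most L over S for every ring T between S and QF(R). When T is the
   intersection of n dicritical divisors, this length is at least n, so that n <= L. When T
   is maximal among the rings above S in which b is not invertible, T is a valuation ring,
   and the bound makes its ideals principal, so that T is a dicritical divisor. *)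

From Stdlib Require Import Ring.
Require Import Defs.
From HB Require Import structures.
From mathcomp Require Import all_boot all_order all_algebra.
From mathcomp Require Import boolp classical_sets functions cardinality.

Import GRing.Theory.
Local Open Scope classical_set_scope.
Local Open Scope ring_scope.

Set Implicit Arguments.
Unset Strict Implicit.
Unset Printing Implicit Defensive.

(** The residue of [z] in [V] is algebraic over [K] exactly when some polynomial over [R] with a
    coefficient outside [m] takes at [z] a value in the maximal ideal of [V]. This is why inverting
    all [f(z)] with [f] primitive loses no dicritical divisor. That neither [z] nor [1/z] is in [R]
    serves to put both terms of a coprime fraction in [m]. Coprimality is obtained without
    factorization: the saturation of [(a, b)] by powers of [x] is principal, dividing by its
    generator puts a power of [x] in the ideal, and the same is done with [y]. The integral closure
    of [S] need not be a finite [S]-module, hence the recourse to a length bound valid for all rings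
    between [S] and [QF(R)]. Counting valuation rings requires elements that separate them; these
    are made from differences [u - z^k], because the powers of [z] have distinct residues even when
    [K] is finite. *)

Section RingTactic.
Variable A : comNzRingType.
Definition radd : A -> A -> A := +%R.
Definition rmul : A -> A -> A := *%R.
Definition ropp : A -> A := -%R.
Definition rexp : A -> nat -> A := @GRing.exp A.
Definition rzero : A := 0.
Definition rone : A := 1.
Lemma rng_theory : ring_theory rzero rone radd rmul (fun x y => radd x (ropp y)) ropp eq.
Proof.
rewrite /radd /rmul /rzero /rone; split=> // *;
  by rewrite ?add0r ?mul1r ?addrA ?mulrA ?mulrDl ?subrr //; rewrite (addrC, mulrC).
Qed.

Lemma radd0_inj a b : radd a rzero = radd b rzero -> a = b.
Proof. by rewrite /radd !addr0. Qed.
End RingTactic.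

Definition rinv (A : unitRingType) : A -> A := @GRing.inv A.

(* The [ring] tactic wants operations of one syntactic carrier, whereas terms of MathComp
   mix several structures; hence the renaming. *)
Ltac rng A := apply: (@radd0_inj A);
  repeat match goal with
  | |- context [@GRing.add ?T ?a ?b] => change (@GRing.add T a b) with (@radd A a b)
  | |- context [@GRing.mul ?T ?a ?b] => change (@GRing.mul T a b) with (@rmul A a b)
  | |- context [@GRing.exp ?T ?a ?n] => change (@GRing.exp T a n) with (@rexp A a n)
  | |- context [@GRing.inv ?T ?a] => change (@GRing.inv T a) with (@rinv A a)
  | |- context [@GRing.opp ?T ?a] => change (@GRing.opp T a) with (@ropp A a)
  | |- context [@GRing.zero ?T] => change (@GRing.zero T) with (@rzero A)
  | |- context [@GRing.one ?T] => change (@GRing.one T) with (@rone A)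
  end; ring.

(** * Ideals, maximal ideals and the ascending chain condition *)

Section Ideals.
Variable A : comNzRingType.
Add Ring Aring : (rng_theory A).

(** Unlike in [idealr_closed], the unit ideal is allowed, so that saturating an ideal or adjoining
    an element requires no proof of properness. *)
Definition is_ideal (I : A -> Prop) : Prop :=
  I 0 /\ forall a u v, I u -> I v -> I (a * u + v).

Definition adjoin (G : A -> Prop) (f : A) : A -> Prop :=
  fun x => exists2 g, G g & exists c, x = g + c * f.

Lemma is_idealM I a u : is_ideal I -> I u -> I (a * u).
Proof. by case=> I0 hI Iu; rewrite -[_ * _]addr0; apply: hI. Qed.

Lemma is_idealD I u v : is_ideal I -> I u -> I v -> I (u + v).
Proof. by case=> I0 hI Iu Iv; rewrite -[u]mul1r; apply: hI. Qed.

Lemma is_idealN I u : is_ideal I -> I u -> I (- u).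
Proof. by move=> hI Iu; rewrite -mulN1r; apply: is_idealM. Qed.

Lemma is_idealB I u v : is_ideal I -> I u -> I v -> I (u - v).
Proof. by move=> hI Iu Iv; apply: is_idealD => //; apply: is_idealN. Qed.

Lemma is_ideal_sum I n (c f : 'I_n -> A) :
  is_ideal I -> (forall i, I (f i)) -> I (\sum_i c i * f i).
Proof.
move=> hI If; elim/big_ind: _ => [|u v|i _]; [exact: hI.1|exact: is_idealD|].
exact: is_idealM.
Qed.

Lemma adjoin_ideal G f : is_ideal G -> is_ideal (adjoin G f).
Proof.
move=> hG; split=> [|a u v [g Gg [c ->]] [h Gh [d ->]]].
  by exists 0; [exact: hG.1|exists 0; rewrite mul0r addr0].
by exists (a * g + h); [exact: hG.2|exists (a * c + d); rng A].
Qed.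

Lemma adjoin_mem G f : is_ideal G -> adjoin G f f.
Proof. by move=> hG; exists 0; [exact: hG.1|exists 1; rewrite mul1r add0r]. Qed.

Lemma principal_is_ideal (t : A) : is_ideal (fun r => exists s, r = s * t).
Proof.
split=> [|a _ _ [s ->] [s' ->]]; first by exists 0; rewrite mul0r.
by exists (a * s + s'); rng A.
Qed.

Lemma is_ideal_pred (I : A -> Prop) :
  is_ideal I -> ~ I 1 -> idealr_closed (fun x => `[<I x>]).
Proof.
move=> [I0 hI] I1; split; first exact/asboolP.
  by apply/negP => /asboolP.
by move=> a u v /asboolP Iu /asboolP Iv; apply/asboolP; apply: hI.
Qed.

Lemma idealr_is_ideal (I : {pred A}) : idealr_closed I -> is_ideal (fun x => x \in I).
Proof. by case=> I0 _ hI; split=> // a u v; apply: hI. Qed.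

Lemma local_mem_nonunit (M : {pred A}) u :
  local_ring M -> (forall v, v * u <> 1) -> u \in M.
Proof.
move=> [_ hM] nu.
pose good (I : set A) := [/\ is_ideal I, I u & ~ I 1].
(* The union of the empty chain is [set0], which has to satisfy [P]. *)
pose P (I : set A) := I = set0 \/ good I.
have [F FP Ftot|I [PI Imax]] := @Zorn_bigcup A P.
  case: (pselect (exists2 I, F I & I !=set0)) => [[I FI [i0 Ii0]]|nF]; last first.
    left; rewrite predeqE => x; split=> // -[I FI Ix]; case: nF.
    by exists I => //; exists x.
  have gF J : F J -> J !=set0 -> good J.
    by move=> FJ [j Jj]; case: (FP _ FJ) => // J0; rewrite J0 in Jj.
  right; have [hI Iu _] := gF _ FI (ex_intro _ _ Ii0).
  split; last 1 first.
  - by move=> [J FJ J1]; have [_ _] := gF J FJ (ex_intro _ _ J1); apply.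
  - split; first by exists I => //; exact: hI.1.
    move=> a v w [J FJ Jv] [J' FJ' J'w].
    have [hJ _ _] := gF J FJ (ex_intro _ _ Jv).
    have [hJ' _ _] := gF J' FJ' (ex_intro _ _ J'w).
    by case: (Ftot _ _ FJ FJ') => sub; [exists J'|exists J] => //;
      (apply: hJ'.2 || apply: hJ.2) => //; apply: sub.
  - by exists I.
have [hI Iu I1] : good I.
  case: PI => // I0.
  have hu : good (fun r => exists s, r = s * u).
    split; [exact: principal_is_ideal|by exists 1; rewrite mul1r|].
    by case=> s /esym; apply: nu.
  exfalso; apply: (Imax _ _ (or_intror hu)); rewrite I0; split=> //.
  by move/(_ u); apply; exists 1; rewrite mul1r.
have hp := is_ideal_pred hI I1.
have maxI : maximal_ideal (fun x => `[<I x>]).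
  split=> // J hJ sub x; apply/idP/idP; last by move/sub.
  apply: contraPT => /asboolPn nIx Jx.
  apply: (Imax (fun x => x \in J)).
    split; first by move=> w /asboolP Iw; apply: sub.
    by move=> sub'; apply: nIx; apply: sub'.
  right; split; [exact: idealr_is_ideal|by apply: sub; apply/asboolP|].
  by case: hJ => _ /negP.
by rewrite -(hM _ maxI); apply/asboolP.
Qed.

Lemma noetherian_acc (I : nat -> A -> Prop) :
  noetherian A -> (forall n, is_ideal (I n)) ->
  (forall n x, I n x -> I n.+1 x) -> exists n, forall x, I n.+1 x -> I n x.
Proof.
move=> nA hI Iinc.
have Ile n k x : (n <= k)%N -> I n x -> I k x.
  by move=> /subnK <-; elim: (k - n)%N => //= d IH /IH; apply: Iinc.
case: (pselect (exists n, I n 1)) => [[n I1]|nI1].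
  by exists n => x _; rewrite -[x]mulr1; apply: is_idealM.
pose U x := exists n, I n x.
have hU : is_ideal U.
  split; first by exists 0%N; exact: (hI _).1.
  move=> a u v [n Iu] [k Iv]; exists (maxn n k); apply: (hI _).2.
    by apply: Ile Iu; rewrite leq_maxl.
  by apply: Ile Iv; rewrite leq_maxr.
have [s hs] := nA _ (is_ideal_pred hU nI1).
have Us i : (i < size s)%N -> U s`_i.
  move=> lti; apply/asboolP; apply: (hs _).2.
  exists (fun j => (nat_of_ord j == i)%:R).
  rewrite (bigD1 (Ordinal lti)) //= eqxx mul1r big1 ?addr0 // => j.
  by rewrite -val_eqE /= => /negPf ->; rewrite mul0r.
have [n hn] : exists n, forall i, (i < size s)%N -> I n s`_i.
  elim: (size s) Us => [|k IH] Us; first by exists 0%N.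
  have [i lti|n hn] := IH; first by apply: Us; apply: ltnW.
  have [l hl] := Us k (ltnSn k).
  exists (maxn n l) => i; rewrite ltnS leq_eqVlt => /orP[/eqP->|lti].
    by apply: Ile hl; rewrite leq_maxr.
  by apply: Ile (hn _ lti); rewrite leq_maxl.
exists n => x Ix; have /(hs _).1 [c ->] : x \in (fun x => `[<U x>]).
  by apply/asboolP; exists n.+1.
by apply: is_ideal_sum => // i; apply: hn.
Qed.

End Ideals.

(** * Noetherian local rings with maximal ideal [(x, y)]: orders modulo [x] and saturated ideals *)

Section LocalRing.
Variables (R : idomainType) (m : idealr R).
Hypotheses (hN : noetherian R) (hL : local_ring m).
Add Ring Rring : (rng_theory R).

Lemma mem_max r : (r \in m) = (r \isn't a GRing.unit).
Proof.
apply/idP/idP => [rm|/unitrPr nu].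
  apply: contraFN (idealr1 m) => ur.
  by rewrite -(mulVr ur); apply: idealMr.
apply: (local_mem_nonunit hL) => v vr.
by apply: nu; exists v; rewrite mulrC.
Qed.

Lemma sub1_unit c r : r \in m -> 1 - c * r \is a GRing.unit.
Proof.
move=> rm; apply: contraFT (idealr1 m); rewrite -mem_max => h.
by rewrite -(subrK (c * r) 1) rpredD // idealMr.
Qed.

(* The chain [G + (f_k)], with [f_k = x f_(k+1)] modulo [G], is stationary, and
   [1 - c x] is a unit. *)
Lemma krull_descent (G P : R -> Prop) (x : R) :
  is_ideal G -> x \in m ->
  (forall f, P f -> exists2 f', P f' & G (f - x * f')) ->
  forall f, P f -> G f.
Proof.
move=> hG xm step f Pf.
have [s hs] : exists s : nat -> R,
    s 0%N = f /\ forall n, P (s n) /\ G (s n - x * s n.+1).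
  pose T := {g : R | P g}.
  have next (t : T) : {t' : T | G (sval t - x * sval t')}.
    apply: cid; case: (step _ (svalP t)) => g Pg Gg.
    by exists (exist _ g Pg).
  pose s := fix s n := if n is k.+1 then sval (next (s k)) else exist _ f Pf : T.
  exists (fun n => sval (s n)); split=> // n; split; first exact: (svalP (s n)).
  exact: (svalP (next (s n))).
case: hs => s0 hs.
have [|n|n|n hn] := @noetherian_acc R (fun n => adjoin G (s n)) => //.
- exact: adjoin_ideal.
- move=> r [g Gg [c ->]]; exists (g + c * (s n - x * s n.+1)).
    by apply: is_idealD => //; apply: is_idealM => //; case: (hs n).
  by exists (c * x); rng R.
have [g Gg [c e]] := hn _ (adjoin_mem _ hG).
have Gsn1 : G (s n.+1).
  have u := sub1_unit c xm.
  rewrite -[s _](mulKr u); apply: is_idealM => //.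
  have -> : (1 - c * x) * s n.+1 = g + c * (s n - x * s n.+1).
    by rewrite [in RHS]mulrBr addrA -e; rng R.
  by apply: is_idealD => //; apply: is_idealM => //; case: (hs n).
have back k : G (s k.+1) -> G (s k).
  move=> Gk; rewrite -(subrK (x * s k.+1) (s k)).
  by apply: is_idealD; [|case: (hs k)|apply: is_idealM].
by rewrite -s0; elim: n {hn e} Gsn1 => [/back|n IH /back/IH].
Qed.

Section Generators.
Variables (x y : R).
Hypotheses (xm : x \in m) (ym : y \in m).
Hypothesis hxy : forall r, r \in m -> exists a b, r = a * x + b * y.

(** The maximal ideal of [R/xR] is generated by [y]. Dividing a class by [y] as long as possible
    ends at a unit, unless the class lies in all powers of the maximal ideal and is 0 by Krull's
    intersection theorem. *)
Lemma order_mod r : (exists s, r = s * x) \/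
  exists e u s, u \is a GRing.unit /\ r = u * y ^+ e + s * x.
Proof.
case: (pselect (exists e u s, u \is a GRing.unit /\ r = u * y ^+ e + s * x)); first by right.
move=> nr; left; pattern r.
apply: (@krull_descent _ (fun r => ~ exists e u s,
  u \is a GRing.unit /\ r = u * y ^+ e + s * x) y) nr => //.
  exact: principal_is_ideal.
move=> f nf; have fm : f \in m.
  rewrite mem_max; apply/negP => uf; apply: nf; exists 0%N, f, 0.
  by split=> //; rewrite expr0 mulr1 mul0r addr0.
have [a [b e]] := hxy fm; exists b; last by exists a; rewrite e; rng R.
move=> [k [u [s [uu e']]]]; apply: nf; exists k.+1, u, (a + s * y).
by split=> //; rewrite e e' exprS; rng R.
Qed.

(** Modulo [x], the ideal is generated by the power of [y] of least exponent that occurs in it; let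
    [g] in [I] lift this generator. If [f - s g = x t], then [t] is in [I] by saturation, so that
    [I = (g) + x I], and Nakayama's argument gives [I = (g)]. *)
Lemma saturated_principal (I : R -> Prop) :
  is_ideal I -> (forall f, I (x * f) -> I f) ->
  exists2 g, I g & forall f, I f -> exists s, f = s * g.
Proof.
move=> hI sat.
have nak g : is_ideal (fun f => exists s, f = s * g) -> I g ->
    (forall f, I f -> exists s t, f = s * g + t * x) ->
    forall f, I f -> exists s, f = s * g.
  move=> hg Ig hf; apply: (krull_descent hg xm) => f If.
  have [s [t e]] := hf f If; exists t; last by exists s; rewrite e; rng R.
  apply: sat; have -> : x * t = f - s * g by rewrite e; rng R.
  by apply: is_idealB => //; apply: is_idealM.
pose Q e := exists u s, u \is a GRing.unit /\ I (u * y ^+ e + s * x).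
case: (pselect (exists e, Q e)) => [ex|nQ].
  have exb : exists e, `[<Q e>] by case: ex => e Qe; exists e; apply/asboolP.
  case: (ex_minnP exb) => e /asboolP [u [s [uu Ig]]] emin.
  exists (u * y ^+ e + s * x) => //; apply: nak => //; first exact: principal_is_ideal.
  move=> f If; case: (order_mod f) => [[t ->]|[k [v [t [uv ef]]]]].
    by exists 0, t; rewrite mul0r add0r.
  have lek : (e <= k)%N.
    by apply: emin; apply/asboolP; exists v, t; split=> //; rewrite -ef.
  exists (v * y ^+ (k - e) / u), (t - v * y ^+ (k - e) / u * s).
  rewrite ef -(subnK lek) exprD addnK.
  set p := y ^+ (k - e); set q := y ^+ e.
  have -> : v * p / u * (u * q + s * x) = v * p * (u^-1 * u) * q + v * p / u * s * x by rng R.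
  by rewrite mulVr //; rng R.
(* Here [I] is contained in [xR], so that [I = x I] by saturation and [I = 0]. *)
exists 0; first exact: hI.1.
apply: nak; [exact: principal_is_ideal|exact: hI.1|].
move=> f If; exists 0; case: (order_mod f) => [[t ->]|[k [v [t [uv ef]]]]].
  by exists t; rewrite mul0r add0r.
by exfalso; apply: nQ; exists k, v, t; rewrite -ef.
Qed.

(** The generator [g] of the saturation of [(a, b)] by powers of [x] plays the part of a greatest
    common divisor: it divides [a] and [b], and a power of [x] times [g] is a combination of
    them. *)
Lemma saturated_cofactors (a b : R) : b != 0 ->
  exists g a' b' n p q,
    [/\ a = a' * g, b = b' * g & x ^+ n = p * a' + q * b'].
Proof.
move=> b0; pose J f := exists n p q, x ^+ n * f = p * a + q * b.
have hJ : is_ideal J.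
  split=> [|c u v [n [p [q e]]] [n' [p' [q' e']]]].
    by exists 0%N, 0, 0; rewrite mulr0 !mul0r addr0.
  exists (n + n')%N, (x ^+ n' * c * p + x ^+ n * p'), (x ^+ n' * c * q + x ^+ n * q').
  rewrite exprD.
  have -> : x ^+ n * x ^+ n' * (c * u + v)
    = x ^+ n' * c * (x ^+ n * u) + x ^+ n * (x ^+ n' * v) by rng R.
  by rewrite e e'; rng R.
have [f [n [p [q e]]]|g [n [p [q e]]] gP] := saturated_principal hJ.
  by exists n.+1, p, q; rewrite exprSr -e; rng R.
have [a' ea] : exists s, a = s * g.
  by apply: gP; exists 0%N, 1, 0; rewrite expr0 mul0r addr0.
have [b' eb] : exists s, b = s * g.
  by apply: gP; exists 0%N, 0, 1; rewrite expr0 mul0r add0r.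
have g0 : g != 0 by apply: contraNneq b0 => g0; rewrite eb g0 mulr0.
exists g, a', b', n, p, q; split=> //; apply: (mulIf g0).
by rewrite e ea eb; rng R.
Qed.

End Generators.
End LocalRing.

(** * Coprimality in dimension two, which is witnessed by a prime [P] strictly between 0 and [m] *)

Section LocalRing.
Variables (R : idomainType) (m : idealr R).
Hypotheses (hN : noetherian R) (hL : local_ring m).
Add Ring Rring : (rng_theory R).

Section DimensionTwo.
Variables (x y : R).
Hypotheses (xm : x \in m) (ym : y \in m).
Hypothesis hxy : forall r, r \in m -> exists a b, r = a * x + b * y.
Variable P : {pred R}.
Hypotheses (hP : prime_ideal P) (Pm : exists2 r, r \in m & r \notin P).
Hypothesis P0 : exists2 r, r \in P & r != 0.

Let hyx r : r \in m -> exists a b, r = a * y + b * x.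
Proof. by move=> /hxy [a [b ->]]; exists b, a; rewrite addrC. Qed.

Lemma nunit_x s : s * x <> 1.
Proof. by move=> e; have := idealr1 m; rewrite -e idealMr. Qed.

Lemma expr_add_mul (a s r : R) e : exists w, (a + s * r) ^+ e = a ^+ e + w * r.
Proof.
elim: e => [|e [w IH]]; first by exists 0; rewrite !expr0 mul0r addr0.
by exists (a * w + s * a ^+ e + s * w * r); rewrite !exprS IH; rng R.
Qed.

Lemma prime_pow (r : R) n : r ^+ n \in P -> r \in P.
Proof.
have [[_ P1 _] Pp] := hP.
elim: n => [|n IH]; first by rewrite expr0 (negPf P1).
by rewrite exprS => /Pp /orP[].
Qed.

Lemma x_or_y_notin : x \in P -> y \in P -> False.
Proof.
move=> xP yP; have iP := idealr_is_ideal hP.1.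
case: Pm => r /hxy [a [b ->]] /negP; apply.
by apply: (is_idealD iP); apply: (is_idealM _ iP).
Qed.

Lemma x_neq0 : x != 0.
Proof.
apply/eqP => x0; have iP := idealr_is_ideal hP.1.
case: P0 => r rP r0; case: (order_mod hN hL ym hxy r) => [[s er]|[e [u [s [uu er]]]]].
  by rewrite er x0 mulr0 eqxx in r0.
apply: x_or_y_notin; first by rewrite x0; exact: iP.1.
apply: (@prime_pow _ e); rewrite -[y ^+ e](mulKr uu).
by apply: (is_idealM _ iP); rewrite er x0 mulr0 addr0 in rP.
Qed.

(* Otherwise a prime strictly between 0 and [m] is principal, generated by some [p]
   with a power in [xR], which is absurd as [p] is prime and does not divide [x]. *)
Lemma powy_notin e s : y ^+ e <> s * x.
Proof.
move=> exy; have [idP Pp] := hP; have iP := idealr_is_ideal idP; have [_ P1 _] := idP.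
have PxN : x \notin P.
  apply/negP => xP; apply: x_or_y_notin => //; apply: (@prime_pow _ e).
  by rewrite exy; apply: (is_idealM s iP).
have sat f : x * f \in P -> f \in P by move=> /Pp; rewrite (negPf PxN).
have [p pP pgen] := saturated_principal hN hL xm ym hxy iP sat.
have p0 : p != 0.
  by case: P0 => r /pgen [t ->]; apply: contraNneq => ->; rewrite mulr0.
have pn n w : p ^+ n <> w * x.
  elim: n w => [|n IH] w; first by rewrite expr0 => /esym; apply: nunit_x.
  move=> e'; have /sat wP : x * w \in P.
    by rewrite mulrC -e' exprS mulrC; apply: (is_idealM _ iP).
  have [t et] := pgen _ wP; apply: (IH t); apply: (mulfI p0).
  by rewrite -exprS e' et; rng R.
case: (order_mod hN hL ym hxy p) => [[w ew]|[k [u [w [uu ep]]]]].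
  by apply: (pn 1%N w); rewrite expr1.
case: k ep => [|k] ep.
  have : p \isn't a GRing.unit.
    apply: contraNN P1 => up; rewrite -(mulVr up); exact: (is_idealM _ iP).
  rewrite -(mem_max hL) => pm.
  have : u \in m.
    have -> : u = p - w * x by rewrite ep expr0; rng R.
    by rewrite rpredB // idealMr.
  by rewrite (mem_max hL) uu.
have [v ev] := expr_add_mul (u * y ^+ k.+1) w x e.
apply: (pn e (u ^+ e * (y ^+ e) ^+ k * s + v)); rewrite ep ev exprMn.
have -> : (y ^+ k.+1) ^+ e = (y ^+ e) ^+ k * (s * x).
  by rewrite -exprM mulnC exprM exprSr exy.
by rng R.
Qed.

(** Modulo [x], nonzero classes are units times powers of [y]. So are their products, and these are
    nonzero because no power of [y] lies in [xR]. *)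
Lemma x_prime a b s : a * b = s * x -> (exists t, a = t * x) \/ (exists t, b = t * x).
Proof.
move=> e.
case: (order_mod hN hL ym hxy a) => [|[i [u [v [uu ea]]]]]; first by left.
case: (order_mod hN hL ym hxy b) => [|[j [u' [v' [uu' eb]]]]]; first by right.
pose w := s - u * y ^+ i * v' - v * u' * y ^+ j - v * v' * x.
exfalso; apply: (@powy_notin (i + j) ((u * u')^-1 * w)).
have uuu : u * u' \is a GRing.unit by rewrite unitrM uu.
apply: (mulrI uuu); rewrite -[_^-1 * w * x]mulrA mulVKr // exprD.
have -> : w * x = s * x - (u * y ^+ i * v' + v * u' * y ^+ j + v * v' * x) * x.
  by rewrite /w; rng R.
by rewrite -e ea eb; rng R.
Qed.

(** As [x] is prime and does not divide [y ^+ d], its [c] factors can be moved into [s] one at a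
    time. *)
Lemma powx_dvd c d s t : s * y ^+ d = t * x ^+ c -> exists s', s = s' * x ^+ c.
Proof.
elim: c s t => [|c IH] s t e; first by exists s; rewrite expr0 mulr1.
have [|[s' es]|[w ew]] := @x_prime s (y ^+ d) (t * x ^+ c).
- by rewrite e exprSr; rng R.
- have [|s2 es2] := IH s' t.
    apply: (mulIf x_neq0); transitivity (s * y ^+ d); first by rewrite es; rng R.
    by rewrite e exprSr; rng R.
  by exists s2; rewrite es es2 exprSr; rng R.
- by case: (@powy_notin d w).
Qed.

(* Both powers being in [(a, b)] says that [a] and [b] are coprime. *)
Lemma dvd_of_dvd_mul a b c p q p' q' g h :
  b != 0 -> x ^+ c = p * a + q * b -> y ^+ c = p' * a + q' * b ->
  g * a = h * b -> exists s, g = s * b.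
Proof.
move=> b0 ex ey e.
have [|s es] := @powx_dvd c c (p * h + q * g) (p' * h + q' * g).
  apply: (mulIf b0).
  have E u v : (u * h + v * g) * b = g * (u * a + v * b).
    by transitivity (u * (h * b) + v * g * b); [|rewrite -e]; rng R.
  transitivity ((p * h + q * g) * b * y ^+ c); first by rng R.
  by rewrite E mulrAC -ex ey -E; rng R.
exists s; have xc0 : x ^+ c != 0 by rewrite expf_neq0 ?x_neq0.
apply: (mulIf xc0); rewrite ex.
transitivity ((p * h + q * g) * b); last by rewrite es ex; rng R.
by transitivity (p * (g * a) + q * g * b); [|rewrite e]; rng R.
Qed.

(** Saturating by [x] and then by [y] is enough: dividing the first cofactors by [h] only enlarges
    the ideal they generate, so the power of [x] stays in it. *)
Lemma coprime_fraction (a b : R) : b != 0 -> exists g a' b' c p q p' q',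
  [/\ a = a' * g, b = b' * g, x ^+ c = p * a' + q * b' & y ^+ c = p' * a' + q' * b'].
Proof.
move=> b0; have [g [a1 [b1 [n [p [q [ea eb ex]]]]]]] := saturated_cofactors hN hL xm ym hxy a b0.
have b10 : b1 != 0 by apply: contraNneq b0; rewrite eb => ->; rewrite mul0r.
have [h [a2 [b2 [k [p' [q' [ea1 eb1 ey]]]]]]] := saturated_cofactors hN hL ym xm hyx a1 b10.
exists (h * g), a2, b2, (n + k)%N, (x ^+ k * p * h), (x ^+ k * q * h), (y ^+ n * p'), (y ^+ n * q').
rewrite ea eb !exprD ey ex ea1 eb1; split; rng R.
Qed.

(* The elements of exponent less than [j] reduce to smaller [j]; if there is none, each [f i]
   is in [tR + xR] and [krull_descent] puts it in [tR]. *)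
Lemma unit_relation j : forall n (f : 'I_n -> R) t u s, (j < n)%N ->
  u \is a GRing.unit -> t = u * y ^+ j + s * x ->
  exists c : 'I_n -> R, (exists i, c i \is a GRing.unit) /\
    exists s, \sum_i c i * f i = s * t.
Proof.
elim/ltn_ind: j => j IH n f t u s ltjn uu et.
pose rel (f : 'I_n -> R) := exists c : 'I_n -> R, (exists i, c i \is a GRing.unit) /\
    exists s, \sum_i c i * f i = s * t.
rewrite -/(rel f).
have low (g : 'I_n -> R) i e v w : (e < j)%N -> v \is a GRing.unit ->
    g i = v * y ^+ e + w * x -> rel g.
  case: n ltjn @rel g i {f} => // n; rewrite ltnS => ltjn rel g i lte uv eg.
  have [|c [[k uk] [r er]]] := IH e lte n (fun k => g (lift i k)) (g i) v w _ uv eg.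
    exact: leq_trans ltjn.
  exists (fun l => if unlift i l is Some k then c k else - r); split.
    by exists (lift i k); rewrite liftK.
  exists 0; rewrite (bigD1_ord i) //= unlift_none.
  under eq_bigr do rewrite liftK.
  by rewrite er; rng R.
apply: contrapT => nrel.
have ft i : exists s, f i = s * t.
  apply: (@krull_descent R m hN hL (fun r => exists s, r = s * t)
    (fun r => exists f, ~ rel f /\ exists i, r = f i) x) => //.
  - exact: principal_is_ideal.
  - move=> _ [g [ng [k ->]]].
    have dec l : exists qr : R * R, g l = qr.1 * t + x * qr.2.
      case: (order_mod hN hL ym hxy (g l)) => [[w ew]|[e [v [w [uv eg]]]]].
        by exists (0, w); rewrite ew /=; rng R.
      have lej : (j <= e)%N by rewrite leqNgt; apply/negP => /low /(_ uv eg).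
      exists (v * y ^+ (e - j) / u, w - v * y ^+ (e - j) / u * s) => /=.
      rewrite eg -(subnK lej) exprD addnK et.
      set a := y ^+ (e - j); set b := y ^+ j.
      transitivity (v * a * (u^-1 * u) * b + w * x); first by rewrite mulVr //; rng R.
      by rng R.
    have [qr hqr] := choice dec.
    exists (qr k).2; last by exists (qr k).1; rewrite hqr; rng R.
    exists (fun l => (qr l).2); split; last by exists k.
    move=> [c [uc [r er]]]; apply: ng; exists c; split=> //.
    exists (\sum_l c l * (qr l).1 + x * r).
    under eq_bigr => l _ do rewrite hqr mulrDr mulrA [c l * (x * _)]mulrCA.
    by rewrite big_split /= -mulr_suml -mulr_sumr er mulrA -mulrDl.
  - by exists f; split=> //; exists i.
have [q hq] := choice ft.
apply: nrel; exists (fun => 1); split.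
  by exists (Ordinal ltjn); exact: unitr1.
by exists (\sum_i q i); rewrite mulr_suml; apply: eq_bigr => i _; rewrite mul1r.
Qed.

End DimensionTwo.
End LocalRing.

(** * Lengths of quotients of [S]-submodules of a field *)

Section Lengths.
Variables (F : fieldType) (S : set F).
Add Ring Fring : (rng_theory F).
Hypotheses (S1 : S 1) (SB : forall u v, S u -> S v -> S (u - v)).
Hypothesis SM : forall u v, S u -> S v -> S (u * v).

Definition submodule (M : set F) : Prop :=
  M 0 /\ forall s u v, S s -> M u -> M v -> M (s * u + v).

Definition sum_set (M N : set F) : set F :=
  [set u | exists2 v, M v & exists2 w, N w & u = v + w].

Definition scale (c : F) (M : set F) : set F := [set c * u | u in M].

(* [A] and [B] themselves need not be submodules. *)
Fixpoint chain (q : nat) (A B : set F) : Prop :=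
  if q is k.+1 then
    exists C, [/\ submodule C, chain k A C, C `<=` B & ~ B `<=` C]
  else A `<=` B.

Definition length_le (A B : set F) (L : nat) : Prop :=
  forall q, chain q A B -> (q <= L)%N.

Lemma S_submodule : submodule S.
Proof.
have S0 : S 0 by rewrite -(subrr 1); apply: SB.
split=> // s u v Ss Su Sv; rewrite -[v]opprK -[- v]sub0r.
by apply: SB; [apply: SM|apply: SB].
Qed.

Lemma submoduleD M u v : submodule M -> M u -> M v -> M (u + v).
Proof. by move=> [_ hM] Mu Mv; rewrite -[u]mul1r; apply: hM. Qed.

Lemma submoduleM M s u : submodule M -> S s -> M u -> M (s * u).
Proof. by move=> [M0 hM] Ss Mu; rewrite -[_ * _]addr0; apply: hM. Qed.

Lemma submoduleB M u v : submodule M -> M u -> M v -> M (u - v).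
Proof.
move=> hM Mu Mv; apply: submoduleD => //; rewrite -mulN1r.
apply: submoduleM => //; rewrite -sub0r; apply: SB => //.
by case: S_submodule.
Qed.

Lemma submoduleI M N : submodule M -> submodule N -> submodule (M `&` N).
Proof.
move=> [M0 hM] [N0 hN]; split=> // s u v Ss [Mu Nu] [Mv Nv].
by split; [apply: hM|apply: hN].
Qed.

Lemma submodule_sum M N : submodule M -> submodule N -> submodule (sum_set M N).
Proof.
move=> [M0 hM] [N0 hN]; split; first by exists 0 => //; exists 0; rewrite ?addr0.
move=> s _ _ Ss [u Mu [v Nv ->]] [u' Mu' [v' Nv' ->]].
exists (s * u + u'); first exact: hM.
by exists (s * v + v'); [exact: hN|rng F].
Qed.

Lemma submodule_scale c M : submodule M -> submodule (scale c M).
Proof.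
move=> [M0 hM]; split; first by exists 0 => //; rewrite mulr0.
move=> s _ _ Ss [u Mu <-] [v Mv <-]; exists (s * u + v); first exact: hM.
by rng F.
Qed.

Lemma chain_mono q A A' B B' :
  A' `<=` A -> B `<=` B' -> chain q A B -> chain q A' B'.
Proof.
move=> AA; elim: q B B' => [|q IH] B B' BB /=.
  by move=> AB x /AA /AB /BB.
move=> [C [hC ch CB nBC]]; exists C; split=> //; first exact: IH ch.
  by move=> x /CB /BB.
by move=> B'C; apply: nBC => x /BB /B'C.
Qed.

Lemma chain_sub q A B : chain q A B -> A `<=` B.
Proof.
elim: q B => [|q IH] B //= [C [hC /IH AC CB nBC]].
exact: subset_trans CB.
Qed.

Lemma chain_cat p q A B C :
  submodule B -> chain p A B -> chain q B C -> chain (p + q) A C.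
Proof.
move=> hB pAB; elim: q C => [|q IH] C.
  by rewrite addn0 => BC; apply: chain_mono pAB.
rewrite addnS /= => -[D [hD ch DC nCD]].
by exists D; split=> //; apply: IH.
Qed.

Lemma chain_scale c q A B : c != 0 -> chain q A B -> chain q (scale c A) (scale c B).
Proof.
move=> c0; have mono M N : M `<=` N -> scale c M `<=` scale c N.
  by move=> MN _ [u /MN Nu <-]; exists u.
elim: q B => [|q IH] B /=; first exact: mono.
move=> [C [hC ch CB nBC]]; exists (scale c C); split.
- exact: submodule_scale.
- exact: IH.
- exact: mono.
- move=> sub; apply: nBC => u Bu.
  have [|v Cv /(mulfI c0) <-] // := sub (c * u).
  by exists u.
Qed.

(* Modular law: each step of the chain is strict in [M] or modulo [M]. *)
Lemma chain_split M q A B : submodule M -> submodule B -> chain q A B ->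
  exists q1 q2, [/\ (q <= q1 + q2)%N, chain q1 (A `&` M) (B `&` M)
    & chain q2 (sum_set A M) (sum_set B M)].
Proof.
move=> hM; have sum_mono A' B' : A' `<=` B' -> sum_set A' M `<=` sum_set B' M.
  by move=> AB _ [u /AB Bu [v Mv ->]]; exists u => //; exists v.
elim: q B => [|q IH] B hB /=.
  move=> AB; exists 0%N, 0%N; split=> //; last exact: sum_mono.
  by move=> x [/AB Bx Mx].
move=> [C [hC ch CB nBC]]; have [q1 [q2 [le ch1 ch2]]] := IH C hC ch.
have sI : C `&` M `<=` B `&` M by move=> x [/CB Bx Mx].
have sD := sum_mono _ _ CB.
case: (pselect (B `&` M `<=` C `&` M)) => [BM|nBM]; last first.
  exists q1.+1, q2; rewrite addSn ltnS; split=> //=; last exact: chain_mono ch2.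
  by exists (C `&` M); split=> //; apply: submoduleI.
exists q1, q2.+1; rewrite addnS ltnS; split=> //; first exact: chain_mono ch1.
exists (sum_set C M); split=> //; first exact: submodule_sum.
move=> sub; apply: nBC => x Bx.
have [|c Cc [v Mv e]] := sub x.
  by exists x => //; exists 0; rewrite ?addr0 //; case: hM.
have [|Cv _] := BM v; last by rewrite e; apply: submoduleD.
split=> //; have -> : v = x - c by rewrite e; rng F.
by apply: submoduleB => //; apply: CB.
Qed.

Lemma length_le_trans A M B L1 L2 : submodule A -> submodule M -> submodule B ->
  A `<=` M -> M `<=` B ->
  length_le A M L1 -> length_le M B L2 -> length_le A B (L1 + L2).
Proof.
move=> hA hM hB AM MB l1 l2 q /(chain_split hM hB) [q1 [q2 [le ch1 ch2]]].
apply: (leq_trans le); apply: leq_add; [apply: l1|apply: l2].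
  by apply: chain_mono ch1 => [x Ax|x []] //; split=> //; apply: AM.
apply: chain_mono ch2 => [x Mx|_ [u Bu [v Mv ->]]].
  by exists 0; [case: hA|exists x; rewrite ?add0r].
by apply: submoduleD => //; apply: MB.
Qed.

Lemma length_le_self A B : submodule A -> B `<=` A -> length_le A B 0.
Proof.
move=> hA BA [|q] //= [C [hC /chain_sub AC CB nBC]].
by exfalso; apply: nBC => x /BA /AC.
Qed.

Lemma length_le_scale c A B L : c != 0 -> length_le A B L ->
  length_le (scale c A) (scale c B) L.
Proof.
have scaleK d M : d != 0 -> scale d^-1 (scale d M) = M.
  move=> d0; rewrite predeqE => u; split=> [[_ [v Mv <-] <-]|Mu].
    by rewrite mulKf.
  by exists (d * u); [exists u|rewrite mulKf].
move=> c0 l q /(@chain_scale c^-1); rewrite invr_eq0 c0 !scaleK // => ch.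
exact/l/ch.
Qed.

Section Local.
Variables (x y : F).
Hypotheses (Sx : S x) (Sy : S y).
Hypothesis S_local : forall s, S s ->
  (s != 0 /\ S s^-1) \/ exists p q, [/\ S p, S q & s = p * x + q * y].

Definition span1 (g : F) : set F := [set s * g | s in S].

Lemma submodule_span1 g : submodule (span1 g).
Proof.
split; first by exists 0; rewrite ?mul0r //; case: S_submodule.
move=> s _ _ Ss [u Su <-] [v Sv <-]; exists (s * u + v); last by rewrite mulrDl mulrA.
by case: S_submodule => _; apply.
Qed.

(** The quotient is cyclic and killed by [x] and [y], hence a vector space of dimension at most one
    over the residue field of [S]. *)
Lemma length_le_residue A g : submodule A -> A (x * g) -> A (y * g) ->
  length_le A (sum_set A (span1 g)) 1.
Proof.
move=> hA Axg Ayg [|[|q]] //= [C [hC [D [hD ch DC nCD]] CB nBC]].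
exfalso; have AD := chain_sub ch.
case/existsNP: nCD => c; case/not_implyP => Cc nDc.
have [a Aa [_ [s Ss <-] ec]] := CB _ Cc.
case: (S_local Ss) => [[s0 Si]|[p [q' [Sp Sq es]]]]; last first.
  apply: nDc; apply: AD; rewrite ec es mulrDl -!mulrA.
  by apply: submoduleD => //; apply: submoduleD => //; apply: submoduleM.
have Cg : C g.
  rewrite -[g](mulKf s0); apply: submoduleM => //.
  have -> : s * g = c - a by rewrite ec; rng F.
  by apply: submoduleB => //; apply: DC; apply: AD.
apply: nBC => _ [a' Aa' [_ [r Sr <-] ->]].
by apply: submoduleD; [|apply/DC/AD|apply: submoduleM].
Qed.

(** Adjoin [x g], then [y g], then [g]. The first two steps have a smaller sum of exponents, and the
    last one is the case of a quotient killed by [x] and [y]. *)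
Lemma length_le_span A g i j : submodule A -> A (x ^+ i * g) -> A (y ^+ j * g) ->
  exists L, length_le A (sum_set A (span1 g)) L.
Proof.
have [n] := ubnP (i + j); elim: n i j A g => // n IH i j A g; rewrite ltnS => le hA Ai Aj.
have triv : A g -> exists L, length_le A (sum_set A (span1 g)) L.
  move=> Ag; exists 0%N; apply: length_le_self => // _ [a Aa [_ [s Ss <-] ->]].
  by apply: submoduleD => //; apply: submoduleM.
case: i le Ai => [|i] le Ai; first by apply: triv; rewrite expr0 mul1r in Ai.
case: j le Aj => [|j] le Aj; first by apply: triv; rewrite expr0 mul1r in Aj.
have subl A' h : A' `<=` sum_set A' (span1 h).
  move=> u A'u; exists u => //; exists 0; rewrite ?addr0 //.
  by case: (submodule_span1 h).
have subr A' h : submodule A' -> sum_set A' (span1 h) h.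
  by move=> [A'0 _]; exists 0 => //; exists h; rewrite ?add0r //; exists 1; rewrite ?mul1r.
have hs A' h : submodule A' -> submodule (sum_set A' (span1 h)).
  by move=> hA'; apply: submodule_sum => //; exact: submodule_span1.
pose A1 := sum_set A (span1 (x * g)).
have hA1 : submodule A1 by apply: hs.
have [L1 l1] : exists L, length_le A A1 L.
  apply: (IH i j.+1) => //.
    by rewrite mulrA -exprSr.
  by rewrite mulrCA; apply: submoduleM.
pose A2 := sum_set A1 (span1 (y * g)).
have hA2 : submodule A2 by apply: hs.
have [L2 l2] : exists L, length_le A1 A2 L.
  apply: (IH i.+1 j) => //; first by rewrite addnS in le.
    by rewrite mulrCA; apply: submoduleM => //; apply: subl.
  by rewrite mulrA -exprSr; apply: subl.
have l3 := length_le_residue (A := A2) (g := g) hA2 (subl _ _ _ (subr _ _ hA)) (subr _ _ hA1).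
exists (L1 + L2 + 1)%N => q ch.
apply: (length_le_trans (M := A2) (B := sum_set A2 (span1 g)) hA hA2) => //.
- exact: hs.
- by move=> u Au; apply/subl/subl.
- by apply: length_le_trans l1 l2 => //; apply: subl.
- apply: chain_mono ch => // _ [u Au [v gv ->]]; exists u; last by exists v.
  by apply/subl/subl.
Qed.

End Local.

(** * The Krull-Akizuki length bound *)

Section KrullAkizuki.
Variables (b : F) (L : nat).
Hypotheses (b0 : b != 0) (Sb : S b) (Slen : length_le (scale b S) S L).
Hypothesis denominators : forall u, exists n, S (b ^+ n * u).

Lemma S_powb n : S (b ^+ n).
Proof. by elim: n => [|n IH]; rewrite ?expr0 // exprS; apply: SM. Qed.

Lemma submodule_powb n M u : submodule M -> M u -> M (b ^+ n * u).
Proof. by move=> hM Mu; apply: submoduleM => //; apply: S_powb. Qed.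

Lemma scale_pow_le n T l : submodule T -> length_le (scale b T) T l ->
  length_le (scale (b ^+ n) T) T (n * l).
Proof.
move=> hT Tlen; elim: n => [|n IH].
  apply: length_le_self; first exact/submodule_scale.
  by move=> u Tu; exists u; rewrite ?expr0 ?mul1r.
have -> : scale (b ^+ n.+1) T = scale b (scale (b ^+ n) T).
  rewrite predeqE => u; split=> [[v Tv <-]|[_ [v Tv <-] <-]].
    by exists (b ^+ n * v); [exists v|rewrite mulrA -exprS].
  by exists v => //; rewrite exprS mulrA.
rewrite mulSnr; apply: (length_le_trans (M := scale b T)) => //.
- exact/submodule_scale/submodule_scale.
- exact: submodule_scale.
- move=> _ [_ [v Tv <-] <-]; exists (b ^+ n * v) => //.
  exact: submodule_powb.
- by move=> _ [v Tv <-]; apply: submoduleM.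
- exact: length_le_scale.
Qed.

(** One element witnesses the strictness of each step. As soon as [b ^+ k] clears the denominators
    of these finitely many witnesses, they survive the intersection. *)
Lemma chain_bounded_denominators q A B : submodule B -> chain q A B ->
  exists n, forall k, (n <= k)%N ->
    chain q (A `&` [set u | S (b ^+ k * u)]) (B `&` [set u | S (b ^+ k * u)]).
Proof.
elim: q B => [|q IH] B hB /=.
  by move=> AB; exists 0%N => k _ u [/AB].
move=> [C [hC ch CB nBC]]; have [n hn] := IH C hC ch.
case/existsNP: nBC => t; case/not_implyP => Bt nCt.
have [d hd] := denominators t.
exists (maxn n d) => k; rewrite geq_max => /andP[nk dk].
exists (C `&` [set u | S (b ^+ k * u)]); split.
- apply: submoduleI => //; split=> [|s u v Ss Su Sv] /=.
    by rewrite mulr0; case: S_submodule.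
  have -> : b ^+ k * (s * u + v) = s * (b ^+ k * u) + b ^+ k * v by rng F.
  by case: S_submodule => _; apply.
- exact: hn.
- by move=> u [/CB Bu].
- move=> sub; apply: nCt; have [] // := sub t; split=> //=.
  by rewrite -(subnK dk) exprD -mulrA; apply: SM => //; exact: S_powb.
Qed.

(* If [M] is the part of [T] with denominator [b ^ k], a chain of length [q] in [M / bM]
   yields one of length [n q] in [M / b^n M], hence between [b^(n+k) S] and [S]; this
   has length at most [(n + k) L], for all [n]. *)
Theorem krull_akizuki T : submodule T -> T 1 -> length_le (scale b T) T L.
Proof.
move=> hT T1 q /(chain_bounded_denominators hT) [k /(_ k (leqnn k))].
set M := T `&` _ => ch.
have hM : submodule M.
  apply: submoduleI => //; split=> [|s u v Ss Su Sv] /=.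
    by rewrite mulr0; case: S_submodule.
  have -> : b ^+ k * (s * u + v) = s * (b ^+ k * u) + b ^+ k * v by rng F.
  by case: S_submodule => _; apply.
have {}ch : chain q (scale b M) M.
  apply: chain_mono ch => // _ [u [Tu Su] <-]; split; first by exists u.
  by rewrite /= mulrCA; apply: SM.
have bk0 n : b ^+ n != 0 by rewrite expf_neq0.
have chn n : chain (n * q) (scale (b ^+ n) M) M.
  elim: n => [|n IH].
    by move=> _ [u Mu <-]; rewrite expr0 mul1r.
  have e : scale (b ^+ n.+1) M = scale (b ^+ n) (scale b M).
    rewrite predeqE => u; split=> [[v Sv <-]|[_ [v Sv <-] <-]].
      by exists (b * v); [exists v|rewrite mulrA -exprSr].
    by exists v => //; rewrite exprSr mulrA.
  rewrite mulSn e; apply: chain_cat IH; last exact: chain_scale.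
  exact: submodule_scale.
have SM1 : S `<=` M.
  move=> u Su; split; last by apply: SM => //; exact: S_powb.
  by rewrite -[u]mulr1; apply: submoduleM.
have bound n : (n * q <= (n + k) * L)%N.
  apply: (scale_pow_le S_submodule Slen); apply: chain_mono (chain_scale (bk0 k) (chn n)).
    move=> _ [u Su <-]; exists (b ^+ n * u).
      by exists u => //; apply: SM1.
    by rewrite mulrA -exprD addnC.
  by move=> _ [u [_ Su] <-].
(* For [n = k L + 1], having [q > L] would give [n (L + 1) <= (n + k) L], that is [n <= k L]. *)
have := bound (k * L).+1; rewrite leqNgt => /negP h; rewrite leqNgt.
apply/negP => Lq; apply: h; apply: leq_trans (leq_mul (leqnn _) Lq).
by rewrite mulnDl mulnS addSn ltnS addnC leq_add // mulSn leq_addl.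
Qed.

End KrullAkizuki.
End Lengths.

(** * The localization [S] of [R[z]] at [m R[z]] *)

Section GaussRing.
Variables (R : idomainType) (m : idealr R).
Let F : fieldType := {fraction R}.
Add Ring Rring : (rng_theory R).
Add Ring Fring : (rng_theory F).

Definition primitive (f : {poly R}) : Prop := exists i, f`_i \notin m.

Definition ev (z : F) (f : {poly R}) : F := (map_poly (@FracField.tofrac R) f).[z].

(* The localization of [R[z]] at [m R[z]]. *)
Definition gauss_ring (z : F) : set F :=
  [set u | exists p f, primitive f /\ u = ev z p / ev z f].

Lemma fraction_num_den (u : F) : exists n d : R, d != 0 /\ u = n%:F / d%:F.
Proof.
elim/quotW: u => r; exists (frac r).1, (frac r).2; split; first exact: denom_ratioP.
have d0 : ((frac r).2)%:F != 0 :> F by rewrite tofrac_eq0 denom_ratioP.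
apply: (mulIf d0); rewrite divfK //; apply/eqP.
rewrite -[_ * _]/(FracField.mul _ _) !piE FracField.equivfE /FracField.mulf.
rewrite !numden_Ratio ?oner_eq0 ?mulf_neq0 ?denom_ratioP ?oner_neq0 //.
by rewrite !mulr1 mulrC.
Qed.

Lemma evM z f g : ev z (f * g) = ev z f * ev z g.
Proof. by rewrite /ev rmorphM hornerM. Qed.

Lemma evD z f g : ev z (f + g) = ev z f + ev z g.
Proof. by rewrite /ev rmorphD hornerD. Qed.

Lemma evB z f g : ev z (f - g) = ev z f - ev z g.
Proof. by rewrite /ev rmorphB hornerD hornerN. Qed.

Lemma ev1 z : ev z 1 = 1.
Proof. by rewrite /ev rmorph1 hornerC. Qed.

Lemma evC z c : ev z c%:P = c%:F.
Proof. by rewrite /ev map_polyC hornerC. Qed.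

Lemma evX z : ev z 'X = z.
Proof. by rewrite /ev map_polyX hornerX. Qed.

Lemma evXn z n : ev z 'X^n = z ^+ n.
Proof. by rewrite /ev map_polyXn hornerXn. Qed.

Lemma ev_wide z (f : {poly R}) n : (size f <= n)%N ->
  ev z f = \sum_(i < n) (f`_i)%:F * z ^+ i.
Proof.
move=> le; rewrite /ev (@horner_coef_wide _ n); last first.
  by apply: leq_trans le; apply: size_poly.
by apply: eq_bigr => i _; rewrite coef_map.
Qed.

Lemma primitive1 : primitive 1.
Proof. by exists 0%N; rewrite coef1 idealr1. Qed.

Hypotheses (hN : noetherian R) (hL : local_ring m).

(** Gauss's lemma: if [i] and [j] are the first indices of coefficients outside [m], the coefficient
    of index [i + j] of the product is their product modulo [m]. *)
Lemma primitive_mul f g : primitive f -> primitive g -> primitive (f * g).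
Proof.
move=> pf pg; case: (ex_minnP pf) => i fi imin; case: (ex_minnP pg) => j gj jmin.
exists (i + j)%N; have lti : (i < (i + j).+1)%N by rewrite ltnS leq_addr.
rewrite coefM (bigD1 (Ordinal lti)) //= addKn.
apply: contra (_ : f`_i * g`_j \notin m); last first.
  by move: fi gj; rewrite !(mem_max hL) !negbK => fi gj; rewrite unitrM fi.
set s := (X in _ + X) => h; have sm : s \in m.
  apply: rpred_sum => k; rewrite -val_eqE /= => ki.
  have [ltki|leik] := ltnP k i.
    rewrite mulrC idealMr //; apply: contraTT ltki => /imin; by rewrite -leqNgt.
  rewrite idealMr //; apply: contraTT (_ : (i < k)%N) => [/jmin|]; last first.
    by rewrite ltn_neqAle eq_sym ki.
  have le := ltn_ord k; rewrite ltnS in le.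
  by rewrite leq_subRL // leq_add2r -leqNgt.
by rewrite -(addrK s (_ * _)) rpredB.
Qed.

Lemma gauss_ring_ev z f : gauss_ring z (ev z f).
Proof. by exists f, 1; rewrite ev1 divr1; split=> //; apply: primitive1. Qed.

Lemma gauss_ring_evV z f : primitive f -> gauss_ring z (ev z f)^-1.
Proof. by move=> pf; exists 1, f; rewrite ev1 mul1r. Qed.

Lemma gauss_ring_frac z r : gauss_ring z r%:F.
Proof. by rewrite -(evC z); apply: gauss_ring_ev. Qed.

Lemma gauss_ringM z u v :
  gauss_ring z u -> gauss_ring z v -> gauss_ring z (u * v).
Proof.
move=> [f [g [pg ->]]] [f' [g' [pg' ->]]]; exists (f * f'), (g * g').
by rewrite !evM invfM; split; [exact: primitive_mul|rng F].
Qed.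

Section Coprime.
Variables (x y : R).
Hypotheses (xm : x \in m) (ym : y \in m).
Hypothesis hxy : forall r, r \in m -> exists a b, r = a * x + b * y.
Variable P : {pred R}.
Hypotheses (hP : prime_ideal P) (Pm : exists2 r, r \in m & r \notin P).
Hypothesis P0 : exists2 r, r \in P & r != 0.
Variables (a b : R) (c : nat) (p q p' q' : R).
Hypotheses (am : a \in m) (bm : b \in m) (b0 : b != 0).
Hypotheses (ex : x ^+ c = p * a + q * b) (ey : y ^+ c = p' * a + q' * b).

Let z : F := a%:F / b%:F.
Let bF0 : b%:F != 0 :> F. Proof. by rewrite tofrac_eq0. Qed.
Let zb : z * b%:F = a%:F. Proof. by rewrite divfK. Qed.

Lemma dvd_of_dvd_mul_pow k g h : g * a ^+ k = h * b -> exists s, g = s * b.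
Proof.
elim: k g h => [|k IH] g h; first by rewrite expr0 mulr1 => ->; exists h.
rewrite exprSr mulrA => /(dvd_of_dvd_mul hN hL xm ym hxy hP Pm P0 b0 ex ey) [s].
exact: IH.
Qed.

(** All terms but the last are divisible by [b], so by coprimality the last coefficient is some
    [s b], which is in [m]. Dividing the relation by [b] lowers the degree and replaces [d n] by
    [d n + s a], which is [d n] modulo [m]. *)
Lemma homogeneous_zero n (d : nat -> R) :
  \sum_(i < n.+1) d i * (a ^+ i * b ^+ (n - i)) = 0 ->
  forall i, (i <= n)%N -> d i \in m.
Proof.
elim: n d => [|n IH] d.
  rewrite big_ord1 !expr0 !mulr1 => e i; rewrite leqn0 => /eqP ->.
  by rewrite e idealr0.
rewrite big_ord_recr /= subnn expr0 mulr1 => e.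
have split_b : \sum_(i < n.+1) d i * (a ^+ i * b ^+ (n.+1 - i))
    = (\sum_(i < n.+1) d i * (a ^+ i * b ^+ (n - i))) * b.
  rewrite mulr_suml; apply: eq_bigr => i _.
  have le : (i <= n)%N by rewrite -ltnS.
  by rewrite subSn // exprSr !mulrA.
have [s es] : exists s, d n.+1 = s * b.
  apply: (@dvd_of_dvd_mul_pow n.+1 _
    (- \sum_(i < n.+1) d i * (a ^+ i * b ^+ (n - i)))).
  by rewrite mulNr -split_b; apply/eqP; rewrite -addr_eq0 addrC e.
have IH' := IH (fun i => if i == n then d n + s * a else d i).
have {}IH' i : (i <= n)%N -> (if i == n then d n + s * a else d i) \in m.
  apply: IH'; rewrite big_ord_recr /= eqxx subnn expr0 mulr1.
  under eq_bigr => k _ do rewrite (ltn_eqF (ltn_ord k)) /=.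
  apply: (mulIf b0); rewrite mul0r; move: e.
  rewrite split_b big_ord_recr /= subnn expr0 mulr1 es exprS.
  set T := \sum_(k < n) _ => e; apply: etrans e.
  by rng R.
move=> i; rewrite leq_eqVlt => /orP[/eqP ->|]; first by rewrite es idealMr.
rewrite ltnS => le; have := IH' i le; case: eqP => [->|//] h.
by rewrite -(addrK (s * a) (d n)) rpredB // idealMr.
Qed.

Lemma ev_homogeneous n (d : nat -> R) :
  (\sum_(i < n.+1) d i * (a ^+ i * b ^+ (n - i)))%:F
  = b%:F ^+ n * \sum_(i < n.+1) (d i)%:F * z ^+ i.
Proof.
rewrite rmorph_sum mulr_sumr; apply: eq_bigr => i _.
have le : (i <= n)%N by rewrite -ltnS.
have -> : b%:F ^+ n = b%:F ^+ (n - i) * b%:F ^+ i :> F by rewrite -exprD subnK.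
rewrite !rmorphM !rmorphXn /= -zb exprMn.
by rng F.
Qed.

(** Multiplied by a power of [b], the relation [f(z) = 0] becomes a homogeneous one between [a] and
    [b], which puts all coefficients of [f] in [m]. This makes the denominators in [S]
    legitimate. *)
Lemma ev_neq0 f : primitive f -> ev z f != 0.
Proof.
move=> [i fi]; apply: contra fi => /eqP e.
have [le|lt] := leqP i (size f); last by rewrite nth_default ?idealr0 // ltnW.
apply: homogeneous_zero le; apply/eqP; rewrite -tofrac_eq0 ev_homogeneous.
by rewrite -ev_wide ?e ?mulr0.
Qed.

Let S := gauss_ring z.

Lemma gauss_ringB u v : S u -> S v -> S (u - v).
Proof.
move=> [f [g [pg ->]]] [f' [g' [pg' ->]]]; exists (f * g' - f' * g), (g * g').
split; first exact: primitive_mul.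
rewrite evB !evM invfM mulrBl; congr (_ - _).
  by rewrite mulrACA divff ?mulr1 // ev_neq0.
by rewrite [_^-1 * _]mulrC mulrACA divff ?mulr1 // ev_neq0.
Qed.

(** A numerator that is not primitive has all its coefficients in [m = (x, y)], hence has the form
    [f1 x + f2 y]. *)
Lemma gauss_ring_local s : S s ->
  (s != 0 /\ S s^-1) \/ exists u v, [/\ S u, S v & s = u * x%:F + v * y%:F].
Proof.
move=> [f [g [pg es]]]; case: (pselect (primitive f)) => [pf|npf].
  left; rewrite es invf_div mulf_neq0 ?invr_neq0 ?ev_neq0 //.
  by split=> //; exists g, f.
right; have fm i : exists rs : R * R, f`_i = rs.1 * x + rs.2 * y.
  have [|r [s' e]] := hxy (r := f`_i); last by exists (r, s').
  by apply: contrapT => /negP fi; apply: npf; exists i.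
have [rs hrs] := choice fm.
pose f1 := \poly_(i < size f) (rs i).1; pose f2 := \poly_(i < size f) (rs i).2.
exists (ev z f1 / ev z g), (ev z f2 / ev z g).
split; [by exists f1, g|by exists f2, g|].
have ef : f = f1 * x%:P + f2 * y%:P.
  apply/polyP => i; rewrite coefD !coefMC !coef_poly.
  by case: ltnP => [_|le]; [exact: hrs|rewrite !mul0r addr0 nth_default].
by rewrite es {1}ef evD !evM !evC; rng F.
Qed.

(** The polynomial [f] with coefficients [d i] is primitive and the relation reads [b^n f(z) = s t],
    so that [b^n / t = s / f(z)]. *)
Lemma gauss_ring_relation t n (d : 'I_n.+1 -> R) s :
  t != 0 -> (exists i, d i \is a GRing.unit) ->
  \sum_i d i * (a ^+ i * b ^+ (n - i)) = s * t -> S (b%:F ^+ n / t%:F).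
Proof.
move=> t0 [i ui] e; pose f := \poly_(i < n.+1) d (inord i).
have fE (k : 'I_n.+1) : f`_k = d k by rewrite coef_poly ltn_ord inord_val.
have pf : primitive f by exists i; rewrite fE (mem_max hL) ui.
exists s%:P, f; split=> //; rewrite evC.
have tF0 : t%:F != 0 :> F by rewrite tofrac_eq0.
apply/eqP; rewrite eqr_div ?ev_neq0 // -rmorphM -e.
have := ev_homogeneous n (fun i => f`_i).
rewrite -ev_wide ?size_poly // => <-; apply/eqP; congr (_%:F).
by apply: eq_bigr => k _; rewrite fE.
Qed.

Lemma gauss_ring_powM u n v k t t' :
  S (b%:F ^+ n * u / t%:F) -> S (b%:F ^+ k * v / t'%:F) ->
  S (b%:F ^+ (n + k) * (u * v) / (t * t')%:F).
Proof.
move=> h h'; have := gauss_ringM h h'; congr S.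
by rewrite rmorphM /= invfM exprD; rng F.
Qed.

(** It is enough to invert [t] in [R]. When [t] has order [j] modulo [x], the [j + 1] forms
    [a^i b^(j - i)] of degree [j] are numerous enough for [unit_relation]. The element [x] is
    treated in the same way modulo [y], where it has order 1. *)
Lemma gauss_ring_denominators u : exists n, S (b%:F ^+ n * u).
Proof.
suff den t : t != 0 -> exists n, S (b%:F ^+ n * 1 / t%:F).
  have [r [t [t0 ->]]] := fraction_num_den u; have [n hn] := den t t0.
  exists n; have := gauss_ringM hn (gauss_ring_frac z r); congr S.
  by rng F.
have x0 : x != 0 := x_neq0 hN hL ym hxy hP Pm P0.
have denx : exists n, S (b%:F ^+ n * 1 / x%:F).
  have hyx r : r \in m -> exists a b, r = a * y + b * x.
    by move=> /hxy [r1 [r2 ->]]; exists r2, r1; rewrite addrC.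
  have [|d [ud [s e]]] := unit_relation hN hL ym xm hyx
    (j := 1) (n := 2) (fun i => a ^+ i * b ^+ (1 - i)) (t := x) (s := 0) isT (unitr1 _).
    by rewrite expr1 mul1r mul0r addr0.
  by exists 1%N; rewrite mulr1; apply: gauss_ring_relation x0 ud e.
have dent t' : (forall s, t' <> s * x) -> exists n, S (b%:F ^+ n * 1 / t'%:F).
  move=> nt; have t0 : t' != 0.
    by apply/eqP => t0; apply: (nt 0); rewrite mul0r.
  case: (order_mod hN hL ym hxy t') => [[s /nt]//|[j [v [s [uv et]]]]].
  have [d [ud [s' e]]] := unit_relation hN hL xm ym hxy
    (n := j.+1) (fun i => a ^+ i * b ^+ (j - i)) (ltnSn j) uv et.
  by exists j; rewrite mulr1; apply: gauss_ring_relation t0 ud e.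
move=> t0; apply: contrapT => nd; move/eqP: t0; apply.
(* A counterexample is divisible by [x] and the quotient is again a counterexample; only 0 can be
   divided by [x] forever. *)
apply: (@krull_descent R m hN hL (fun r => r = 0)
  (fun t => ~ exists n, S (b%:F ^+ n * 1 / t%:F)) x) nd => //.
  by split=> // a' u' v -> ->; rewrite mulr0 addr0.
move=> t' nt; have [s es] : exists s, t' = s * x.
  apply: contrapT => ns; apply: nt; apply: dent => s es; apply: ns; by exists s.
exists s; last by rewrite es; rng R.
move=> [n hn]; apply: nt; have [k hk] := denx; exists (n + k)%N.
by rewrite es; have := gauss_ring_powM hn hk; rewrite mulr1.
Qed.

(** Division of [ex] by [b] gives [x^c / b = p z + q]. With [x^c] and [y^c] in [bS], the ring [S/bS]
    has finite length. *)
Lemma gauss_ring_powx : S (x%:F ^+ c / b%:F) /\ S (y%:F ^+ c / b%:F).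
Proof.
have gen u v : S ((u * a + v * b)%:F / b%:F).
  exists (u *: 'X + v%:P), 1; split; first exact: primitive1.
  rewrite ev1 divr1 evD -mul_polyC evM !evC evX rmorphD !rmorphM /= mulrDl.
  by rewrite mulfK // -mulrA.
by rewrite -!rmorphXn ex ey; split; apply: gen.
Qed.

Lemma gauss_ring_length : exists L, length_le S (scale b%:F S) S L.
Proof.
have S1 : S 1 by rewrite -(ev1 z); apply: gauss_ring_ev.
have hS := S_submodule S1 gauss_ringB (@gauss_ringM z).
have [hx hy] := gauss_ring_powx.
have bmem u : S (u / b%:F) -> scale b%:F S (u * 1).
  by move=> Su; exists (u / b%:F) => //; rewrite mulr1 mulrC divfK.
have [L hL'] := length_le_span S1 gauss_ringB (@gauss_ringM z) (gauss_ring_frac z x)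
  (gauss_ring_frac z y) gauss_ring_local (submodule_scale b%:F hS) (bmem _ hx) (bmem _ hy).
exists L => n ch; apply: hL'; apply: chain_mono ch => // u Su.
exists 0; first by case: (submodule_scale b%:F hS).
by exists u; rewrite ?add0r //; exists u; rewrite ?mulr1.
Qed.

End Coprime.
End GaussRing.

(** * Counting the valuation rings of rank one above [S] *)

Section ValuationSubsets.
Variables (F : fieldType) (S : set F) (b z : F) (L : nat).
Add Ring Fring : (rng_theory F).
Hypotheses (S1 : S 1) (SB : forall u v, S u -> S v -> S (u - v)).
Hypothesis SM : forall u v, S u -> S v -> S (u * v).
Hypotheses (b0 : b != 0) (Sb : S b) (Slen : length_le S (scale b S) S L).
Hypothesis denominators : forall u, exists n, S (b ^+ n * u).

Definition is_subring (V : set F) : Prop :=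
  [/\ V 1, forall u v, V u -> V v -> V (u - v) & forall u v, V u -> V v -> V (u * v)].

(* The last clause says that the valuation has rank one. *)
Definition valuation_above (V : set F) : Prop :=
  [/\ is_subring V, S `<=` V, ~ V b^-1, forall u, ~ V u -> V u^-1
    & forall u, ~ V u -> exists n, V (b * u ^+ n)^-1].

Section Subring.
Variable V : set F.
Hypothesis hV : is_subring V.

Lemma subring0 : V 0.
Proof. by case: hV => V1 VB _; rewrite -(subrr 1); apply: VB. Qed.

Lemma subringN u : V u -> V (- u).
Proof. by case: hV => _ VB _ Vu; rewrite -sub0r; apply: VB => //; apply: subring0. Qed.

Lemma subringD u v : V u -> V v -> V (u + v).
Proof. by case: (hV) => _ VB _ Vu Vv; rewrite -[v]opprK; apply: VB => //; apply: subringN. Qed.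

Lemma subringM u v : V u -> V v -> V (u * v).
Proof. by case: hV => _ _; apply. Qed.

Lemma subringX u n : V u -> V (u ^+ n).
Proof.
move=> Vu; elim: n => [|n IH]; first by rewrite expr0; case: hV.
by rewrite exprS; apply: subringM.
Qed.

Lemma subring_submodule : S `<=` V -> submodule S V.
Proof.
move=> SV; split=> [|s u v Ss Vu Vv]; first exact: subring0.
by apply: subringD => //; apply: subringM => //; apply: SV.
Qed.

End Subring.

Section Finiteness.
Hypothesis Sz : S z.
Hypothesis Sz_unit : forall k l, k != l ->
  z ^+ k - z ^+ l != 0 /\ S (z ^+ k - z ^+ l)^-1.

(** An element [u] of [W] outside [V] would bring [b^-1 = u^n (b u^n)^-1] into [W], by the rank one
    clause for [V]. *)
Lemma valuation_above_max V W : valuation_above V -> valuation_above W ->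
  V `<=` W -> V = W.
Proof.
move=> [hV _ _ _ Vr] [hW _ Wb _ _] VW; rewrite eqEsubset; split=> // u Wu.
apply: contrapT => nVu; have [n hn] := Vr u nVu; apply: Wb.
have u0 : u != 0 by apply: contra_notN nVu => /eqP ->; apply: subring0.
have -> : b^-1 = u ^+ n * (b * u ^+ n)^-1.
  by rewrite invfM mulrCA divff ?mulr1 // expf_neq0.
by apply: subringM => //; [apply: subringX|apply: VW].
Qed.

(* The [z ^ k] have distinct residues, so at most one of them is the residue of [u]. *)
Lemma shift_unit V u k l : valuation_above V ->
  ~ V (u - z ^+ k)^-1 -> ~ V (u - z ^+ l)^-1 -> k = l.
Proof.
move=> [hV SV _ Vv _].
have claim i j : i != j -> V ((u - z ^+ i) / (u - z ^+ j)) -> V (u - z ^+ j)^-1.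
  (* The inverse of 0 is 0, an element of [V]. *)
  move=> ij Vij; have [e|q0] := eqVneq (u - z ^+ j) 0.
    by rewrite e invr0; apply: subring0.
  rewrite eq_sym in ij; have [w0 Sw] := Sz_unit ij.
  have -> : (u - z ^+ j)^-1
      = ((u - z ^+ i) / (u - z ^+ j) - 1) * (z ^+ j - z ^+ i)^-1.
    apply: (mulIf w0); rewrite divfK //.
    rewrite -[in RHS](divff q0) -mulrBl mulrC; congr (_ / _); by rng F.
  apply: subringM => //; last exact: SV.
  by apply: subringD => //; apply: subringN => //; case: hV.
move=> nk nl; apply/eqP/negPn/negP => kl.
case: (pselect (V ((u - z ^+ k) / (u - z ^+ l)))) => [/(claim _ _ kl)//|/Vv].
by rewrite invf_div => /claim; rewrite eq_sym => /(_ kl).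
Qed.

Section Family.
Variable V_ : nat -> set F.

(** Each [V_ i] excludes at most one exponent, so all large exponents suit all of the rings. *)
Lemma shift_units n u : (forall i, (i < n)%N -> valuation_above (V_ i)) ->
  exists k, forall i, (i < n)%N -> V_ i (u - z ^+ k)^-1.
Proof.
move=> hV; suff [k hk] : exists k, forall l, (k <= l)%N ->
    forall i, (i < n)%N -> V_ i (u - z ^+ l)^-1 by exists k; apply: hk.
elim: n hV => [|n IH] hV; first by exists 0%N.
have [|k hk] := IH; first by move=> i lti; apply: hV; apply: ltnW.
have [k' hk'] : exists k', forall l, (k' <= l)%N -> V_ n (u - z ^+ l)^-1.
  case: (pselect (exists j, ~ V_ n (u - z ^+ j)^-1)) => [[j nj]|all]; last first.
    by exists 0%N => l _; apply: contrapT => nl; apply: all; exists l.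
  exists j.+1 => l ltjl; apply: contrapT => nl.
  by rewrite (shift_unit (hV n (ltnSn n)) nj nl) ltnn in ltjl.
exists (maxn k k') => l; rewrite geq_max => /andP[kl k'l] i.
rewrite ltnS leq_eqVlt => /orP[/eqP ->|]; [exact: hk'|exact: hk].
Qed.

Variable n : nat.
Hypothesis hV : forall i, (i < n)%N -> valuation_above (V_ i).
Hypothesis V_inj : forall i j, (i < n)%N -> (j < n)%N -> V_ i = V_ j -> i = j.

Let T : set F := [set t | forall i, (i < n)%N -> V_ i t].

Let hT : is_subring T.
Proof.
split=> [i /hV [[]]//|u v Tu Tv i lti|u v Tu Tv i lti];
  have [[_ VB VM] _ _ _ _] := hV lti.
- by apply: VB; [apply: Tu|apply: Tv].
- by apply: VM; [apply: Tu|apply: Tv].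
Qed.

Let ST : S `<=` T.
Proof. by move=> u Su i /hV [_ SV _ _ _]; apply: SV. Qed.

(** Take [u] in [V_ k] but not in [V_ i], and shift it to [w = u - z^l] with [w^-1] in every ring of
    the family. Then [w] is a unit of [V_ k] and [w^-1] a nonunit of [V_ i], so that rank one makes
    a power of [w^-1] divisible by [b] in [V_ i]. *)
Lemma separate k i : (k < n)%N -> (i < n)%N -> i != k ->
  exists t, [/\ T t, t != 0, V_ k t^-1 & V_ i (t / b)].
Proof.
move=> ltk lti ik; have [hk Sk _ _ _] := hV ltk; have [hi Si _ _ ri] := hV lti.
have [u Vku nViu] : exists2 u, V_ k u & ~ V_ i u.
  apply: contrapT => nu; move/eqP: ik; apply; apply: V_inj => //; apply/esym.
  apply: valuation_above_max; [exact: hV|exact: hV|move=> u Vu].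
  by apply: contrapT => nViu; apply: nu; exists u.
have [l hl] := shift_units u hV.
have Szl V : is_subring V -> S `<=` V -> V (z ^+ l).
  by move=> hW SV; apply: subringX => //; apply: SV.
have nVi : ~ V_ i (u - z ^+ l).
  move=> Vi; apply: nViu; rewrite -(subrK (z ^+ l) u).
  by apply: subringD => //; apply: Szl.
have w0 : u - z ^+ l != 0.
  by apply: contra_notN nVi => /eqP ->; apply: subring0.
have [e he] := ri _ nVi.
exists ((u - z ^+ l)^-1 ^+ e); split.
- by move=> j ltj; apply: subringX; [case: (hV ltj)|exact: hl].
- by rewrite expf_neq0 ?invr_neq0.
- rewrite -exprVn invrK; apply: subringX => //.
  by case: (hk) => _ VB _; apply: VB => //; apply: Szl.
- by rewrite exprVn -invfM mulrC.
Qed.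

Lemma separates k l : (k < n)%N -> (l <= k)%N ->
  exists t, [/\ T t, t != 0, V_ k t^-1 & forall i, (i < l)%N -> V_ i (t / b)].
Proof.
move=> ltk; elim: l => [|l IH] lek.
  by exists 1; rewrite invr1 oner_eq0; split=> //; [case: hT|case: (hV ltk) => -[]].
have [t [Tt t0 Vkt hl]] := IH (ltnW lek).
have ltl : (l < n)%N := ltn_trans lek ltk.
have [s [Ts s0 Vks Vls]] := separate ltk ltl (negbT (ltn_eqF lek)).
exists (t * s); split; [exact: (subringM hT)|by rewrite mulf_neq0| |].
  by rewrite invfM; apply: subringM => //; case: (hV ltk).
move=> i; rewrite ltnS leq_eqVlt => /orP[/eqP ->|lti].
  rewrite -mulrA; apply: subringM => //; first by case: (hV ltl).
  exact: Tt.
rewrite mulrAC; have ltin := ltn_trans lti ltl.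
by apply: subringM; [case: (hV ltin)|exact: hl|exact: Ts].
Qed.

(** The submodules [M k] of elements divisible by [b] in the first [k] rings descend from [T] to
    [M n], which contains [bT]. Each inclusion is strict: an element of [M k] that is a unit of
    [V_ k] is not divisible by [b] there. *)
Lemma card_valuation_above : (n <= L)%N.
Proof.
have hTs := subring_submodule hT ST.
apply: (krull_akizuki S1 SB SM b0 Sb Slen denominators hTs); first by case: hT.
pose M k : set F := [set t | T t /\ forall i, (i < k)%N -> V_ i (t / b)].
have hM k : (k <= n)%N -> submodule S (M k).
  move=> lek; split=> [|s u v Ss [Tu hu] [Tv hv]].
    split; first by case: hTs.
    by move=> i lti; rewrite mul0r; apply: subring0; case: (hV (leq_trans lti lek)).
  split=> [|i lti]; first by case: hTs => _; apply.
  have [hi Si _ _ _] := hV (leq_trans lti lek).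
  rewrite mulrDl -mulrA; apply: subringD => //; last exact: hv.
  by apply: subringM; [|exact: Si|exact: hu].
suff ch k : (k <= n)%N -> chain S k (M k) T.
  apply: chain_mono (ch n (leqnn n)) => // _ [t Tt <-]; split.
    by apply: (subringM hT) => //; apply: ST.
  by move=> i lti; rewrite mulrAC mulfV // mul1r; apply: Tt.
elim: k => [|k IH] ltk; first by move=> t [].
rewrite -add1n; apply: chain_cat (IH (ltnW ltk)); first exact/hM/ltnW.
exists (M k.+1); split=> //; first exact: hM.
  by move=> t [Tt ht]; split=> // i lti; apply: ht; apply: ltnW.
have [t [Tt t0 Vkt hl]] := separates ltk (leqnn k).
move=> sub; have [|_ /(_ k (ltnSn k)) Vkb] := sub t; first by split.
have [hk _ nb _ _] := hV ltk; apply: nb.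
have -> : b^-1 = t^-1 * (t / b) by rewrite mulKf.
exact: subringM.
Qed.

End Family.
End Finiteness.
End ValuationSubsets.

(** * Existence of a valuation ring above [S] in which [b] is not invertible *)

Section ExistsValuation.
Variables (F : fieldType) (S : set F) (b : F).
Add Ring Fring : (rng_theory F).
Hypotheses (hS : is_subring S) (b0 : b != 0) (Sb : S b) (nSb : ~ S b^-1).

Definition avoids (V : set F) : Prop := [/\ is_subring V, S `<=` V & ~ V b^-1].

Lemma exists_maximal_avoiding : exists V, avoids V /\
  forall W, is_subring W -> V `<=` W -> ~ W `<=` V -> W b^-1.
Proof.
pose P (V : set F) := V = set0 \/ avoids V.
have [G GP Gtot|V [PV Vmax]] := @Zorn_bigcup F P.
  case: (pselect (exists2 V, G V & V !=set0)) => [[V GV [v0 Vv0]]|nG]; last first.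
    left; rewrite predeqE => v; split=> // -[V GV Vv]; case: nG.
    by exists V => //; exists v.
  have aG W w : G W -> W w -> avoids W.
    by move=> GW Ww; case: (GP _ GW) => // W0; rewrite W0 in Ww.
  right; have [[V1 _ _] SV _] := aG _ _ GV Vv0.
  have common u v : (\bigcup_(X in G) X) u -> (\bigcup_(X in G) X) v ->
      exists W, [/\ G W, W u & W v].
    move=> [W GW Wu] [W' GW' W'v]; case: (Gtot _ _ GW GW') => sub.
      by exists W'; split=> //; apply: sub.
    by exists W; split=> //; apply: sub.
  split; last by move=> [W GW Wb]; have [_ _] := aG _ _ GW Wb; apply.
  - split; first by exists V.
      move=> u v Uu Uv; have [W [GW Wu Wv]] := common _ _ Uu Uv.
      by exists W => //; have [[_ WB _] _ _] := aG _ _ GW Wu; apply: WB.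
    move=> u v Uu Uv; have [W [GW Wu Wv]] := common _ _ Uu Uv.
    by exists W => //; have [[_ _ WM] _ _] := aG _ _ GW Wu; apply: WM.
  - by move=> u Su; exists V => //; apply: SV.
have aV : avoids V.
  case: PV => // V0; have aS : avoids S by split.
  exfalso; apply: (Vmax S _ (or_intror aS)); rewrite V0; split=> //.
  by move/(_ 1); apply; case: hS.
exists V; split=> // W hW VW nWV; apply: contrapT => nWb.
apply: (Vmax W); first by split.
by right; split=> //; case: aV => _ SV _; apply: subset_trans VW.
Qed.

Section Maximal.
Variable V : set F.
Hypothesis aV : avoids V.
Hypothesis Vmax : forall W, is_subring W -> V `<=` W -> ~ W `<=` V -> W b^-1.

Let hV : is_subring V. Proof. by case: aV. Qed.
Let Vb : V b. Proof. by case: aV => _ SV _; apply: SV. Qed.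

(** The ring [V[1/s]] is strictly larger than [V], so it contains [b^-1]. *)
Lemma maximal_nonunit_pow s : V s -> ~ V s^-1 -> exists n, V (s ^+ n / b).
Proof.
move=> Vs nVs.
have s0 : s != 0.
  by apply: contra_notN nVs => /eqP ->; rewrite invr0; apply: subring0.
have [] : [set u | exists n, V (s ^+ n * u)] b^-1; last by move=> n hn; exists n.
apply: Vmax.
- split.
  + by exists 0%N; rewrite expr0 mulr1; case: hV.
  + move=> u v [n hn] [k hk]; exists (n + k)%N.
    have -> : s ^+ (n + k) * (u - v) = s ^+ k * (s ^+ n * u) - s ^+ n * (s ^+ k * v).
      by rewrite exprD; rng F.
    by case: (hV) => _ VB VM; apply: VB; apply: VM => //; apply: subringX.
  + move=> u v [n hn] [k hk]; exists (n + k)%N.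
    have -> : s ^+ (n + k) * (u * v) = (s ^+ n * u) * (s ^+ k * v).
      by rewrite exprD; rng F.
    exact: subringM.
- by move=> u Vu; exists 0%N; rewrite expr0 mul1r.
- move=> sub; apply: nVs; apply: sub; exists 1%N.
  by rewrite expr1 mulfV //; case: hV.
Qed.

(** The filtration of [V[u]] by degree: the descent below is on the degrees in which [b^-1] can be
    expressed. *)
Fixpoint polys (u : F) (n : nat) (w : F) : Prop :=
  if n is k.+1 then exists c v, [/\ V c, polys u k v & w = v + c * u ^+ n] else V w.

Lemma polys_linear u n c w w' : V c -> polys u n w -> polys u n w' -> polys u n (c * w + w').
Proof.
move=> Vc; elim: n w w' => [|n IH] w w' /=.
  by move=> Vw Vw'; apply: subringD => //; apply: subringM.
move=> [d [v [Vd hv ->]]] [d' [v' [Vd' hv' ->]]]; exists (c * d + d'), (c * v + v').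
split; [by apply: subringD => //; apply: subringM|exact: IH|rng F].
Qed.

Lemma polys_base u n v : V v -> polys u n v.
Proof.
elim: n => //= n IH Vv; exists 0, v; rewrite mul0r addr0; split=> //; last exact: IH.
exact: subring0.
Qed.

Lemma polysM u n c w : V c -> polys u n w -> polys u n (c * w).
Proof.
move=> Vc hw; rewrite -[_ * _]addr0; apply: polys_linear => //.
by apply: polys_base; apply: subring0.
Qed.

Lemma polys_widen u n w : polys u n w -> polys u n.+1 w.
Proof.
by move=> hw; exists 0, w; rewrite mul0r addr0; split=> //; apply: subring0.
Qed.

Lemma polys_widen_add u n k w : polys u n w -> polys u (n + k) w.
Proof.
by elim: k => [|k IH]; rewrite ?addn0 // => /IH; rewrite addnS; apply: polys_widen.
Qed.

Lemma polys_shift u n k w : polys u k w -> polys u (k + n) (u ^+ n * w).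
Proof.
elim: k w => [|k IH] w /=.
  move=> Vw; case: n => [|n]; first by rewrite expr0 mul1r.
  exists w, 0; rewrite add0r mulrC; split=> //; by apply: polys_base; apply: subring0.
move=> [c [v [Vc hv ->]]]; exists c, (u ^+ n * v); split=> //; first exact: IH.
by rewrite -addSn exprD; rng F.
Qed.

Lemma polys_mul u n k w w' : polys u n w -> polys u k w' -> polys u (n + k) (w * w').
Proof.
move=> + hw'; elim: n w => [|n IH] w /=.
  by rewrite add0n => Vw; apply: polysM.
move=> [c [v [Vc hv ->]]].
have -> : (v + c * u ^+ n.+1) * w' = c * (u ^+ n.+1 * w') + v * w' by rng F.
apply: (@polys_linear _ (n + k).+1) => //.
  by rewrite -addSn addnC; apply: polys_shift.
by apply: polys_widen; apply: IH.
Qed.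

Lemma polys_constant_term u n w : polys u n.+1 w ->
  exists c v, [/\ V c, polys u n v & w = c + u * v].
Proof.
elim: n w => [|n IH] w.
  by move=> [c [v [Vc Vv ->]]]; exists v, c; split=> //; rewrite expr1 mulrC.
move=> [c [v [Vc /IH [d [v' [Vd hv' ->]]] ->]]]; exists d, (v' + c * u ^+ n.+1).
by split=> //; [exists c, v'|rewrite [u ^+ n.+2]exprS; rng F].
Qed.

(** Otherwise some power of [1 - b q] is divisible by [b]; since all its powers are 1 modulo [b],
    this would make [b] a unit. *)
Lemma maximal_unit q : V q -> V (1 - b * q)^-1.
Proof.
move=> Vq; apply: contrapT => ne; have [hW _ nb] := aV.
have [||n hn] := @maximal_nonunit_pow (1 - b * q) => //.
  by case: (hV) => V1 VB VM; apply: VB => //; apply: VM.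
have [r [Vr er]] : exists r, V r /\ (1 - b * q) ^+ n = 1 - b * r.
  elim: (n) => [|k [r [Vr e]]].
    by exists 0; rewrite expr0 mulr0 subr0; split=> //; apply: subring0.
  exists (r + q - b * q * r); split; last by rewrite exprS e; rng F.
  case: (hV) => V1 VB VM; apply: VB; first exact: subringD.
  by do 2!apply: subringM => //.
apply: nb; have -> : b^-1 = (1 - b * q) ^+ n / b + r.
  by rewrite er mulrBl mul1r mulrAC mulfV // mul1r subrK.
exact: subringD.
Qed.

(* From [1/b = q + w/u] comes [u = b w / (1 - b q)], which is then used to lower the degree
   of an expression in [u]. *)
Lemma polys_lower u n k : u != 0 -> (k <= n)%N ->
  polys u n.+1 b^-1 -> polys u^-1 k.+1 b^-1 -> polys u n b^-1.
Proof.
move=> u0 lekn [c [v [Vc hv e]]] /polys_constant_term [q [w [Vq hw e']]].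
have Ve := maximal_unit Vq; rewrite e.
have e0 : 1 - b * q != 0.
  apply/eqP => e0; have w0 : w = 0.
    have : u^-1 * w = 0.
      apply: (mulfI b0); rewrite mulr0 -e0 -(mulfV b0) e'; rng F.
    by move/eqP; rewrite mulf_eq0 invr_eq0 (negPf u0) => /eqP.
  by case: aV => _ _; rewrite e' w0 mulr0 addr0; apply.
have eu : u = b / (1 - b * q) * w.
  have -> : w = u * (u^-1 * w) by rewrite mulVKf.
  have -> : u^-1 * w = (1 - b * q) / b.
    by rewrite mulrBl mul1r mulrAC mulfV // mul1r e'; rng F.
  have -> : b / (1 - b * q) * (u * ((1 - b * q) / b))
    = u * (b / b) * ((1 - b * q) / (1 - b * q)) by rng F.
  by rewrite !mulfV // !mulr1.
have low j i x : polys u^-1 j x -> (j <= i)%N -> polys u i (u ^+ i * x).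
  elim: j x => [|j IH] x /=.
    by move=> Vx _; have := @polys_shift u i 0 x Vx; rewrite add0n.
  move=> [d [y [Vd hy ->]]] ltji; rewrite mulrDr addrC mulrCA.
  have -> : u ^+ i * u^-1 ^+ j.+1 = u ^+ (i - j.+1) * 1.
    by rewrite -{1}(subnK ltji) exprD exprVn mulfK ?mulr1 // expf_neq0.
  apply: polys_linear => //; last exact/IH/ltnW.
  have V1 : V 1 by case: hV.
  have := polys_widen_add j.+1 (@polys_shift u (i - j.+1) 0 1 V1).
  by rewrite add0n subnK.
rewrite addrC; apply: polys_linear => //; rewrite exprSr {3}eu mulrCA.
by apply: polysM; [apply: subringM|apply: low hw lekn].
Qed.

(** Chevalley's argument: if both fail, [b^-1] is a polynomial in [u] and one in [u^-1] by
    maximality. The larger of the two degrees can be lowered until one of them is 0, and then [b^-1]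
    is in [V]. *)
Lemma maximal_valuation u : ~ V u -> V u^-1.
Proof.
move=> nVu; apply: contrapT => nVi.
have u0 : u != 0 by apply: contra_notN nVu => /eqP ->; apply: subring0.
have reach w : ~ V w -> exists n, polys w n b^-1.
  move=> nVw; apply: (Vmax (W := [set v | exists n, polys w n v])).
  - split; first by exists 0%N; case: hV.
      move=> v v' [n hn] [k hk]; exists (n + k)%N; rewrite addrC -mulN1r.
      apply: polys_linear; first by apply: subringN => //; case: hV.
        by rewrite addnC; apply: polys_widen_add.
      exact: polys_widen_add.
    by move=> v v' [n hn] [k hk]; exists (n + k)%N; apply: polys_mul.
  - by move=> v Vv; exists 0%N.
  - move=> sub; apply: nVw; apply: sub; exists 1%N, 1, 0.
    by rewrite add0r mul1r; split=> //; [case: hV|apply: subring0].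
have [[n hn] [k hk]] := (reach _ nVu, reach _ nVi).
have [l] := ubnP (n + k); elim: l n k hn hk => // l IH [|n] [|k] hn hk; last 1 first.
- rewrite ltnS => le; have [lekn|ltnk] := leqP k n.
    by apply: (IH n k.+1); [exact: polys_lower hn hk|exact: hk|].
  apply: (IH n.+1 k); [exact: hn| |by rewrite addnS in le].
  by apply: (polys_lower (k := n)); rewrite ?invr_eq0 ?invrK // ltnW.
all: by case: aV => _ _ nb _; apply: nb.
Qed.

Lemma maximal_valuation_above : valuation_above S b V.
Proof.
case: (aV) => _ SV nb; split=> //; first exact: maximal_valuation.
move=> u nVu; have [||n hn] := @maximal_nonunit_pow u^-1; rewrite ?invrK //.
  exact: maximal_valuation.
by exists n; rewrite invfM mulrC -exprVn.
Qed.

End Maximal.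

Lemma exists_valuation_above : exists V, valuation_above S b V.
Proof.
have [V [aV Vmax]] := exists_maximal_avoiding; exists V.
exact: maximal_valuation_above.
Qed.

End ExistsValuation.

(** * Ideals of these valuation rings are principal *)

Section Principal.
Variables (F : fieldType) (S : set F) (b : F) (L : nat).
Hypotheses (S1 : S 1) (SB : forall u v, S u -> S v -> S (u - v)).
Hypothesis SM : forall u v, S u -> S v -> S (u * v).
Hypotheses (b0 : b != 0) (Sb : S b) (Slen : length_le S (scale b S) S L).
Hypothesis denominators : forall u, exists n, S (b ^+ n * u).
Variable V : set F.
Hypothesis hV : valuation_above S b V.

(* A strictly increasing sequence of principal ideals would be a chain of unbounded length. *)
Lemma valuation_above_principal (I : set F) : I 0 ->
  (forall c u v, V c -> I u -> I v -> I (c * u + v)) -> I `<=` V ->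
  exists2 g, I g & forall f, I f -> exists2 c, V c & f = c * g.
Proof.
move=> I0 IM IV; apply: contrapT => nprin.
have [hVr SV _ Vv _] := hV.
have next g : I g -> exists2 h, I h & ~ exists2 c, V c & h = c * g.
  move=> Ig; apply: contrapT => nh; apply: nprin; exists g => // f If.
  by apply: contrapT => nf; apply: nh; exists f.
have [c0 Ic0 nc0] := next 0 I0.
have c00 : c0 != 0.
  by apply/eqP => c00; apply: nc0; exists 0; rewrite ?mulr0 //; apply: subring0.
have VS := subring_submodule hVr SV.
have grow q : exists c, [/\ I c, c != 0 & chain S q (scale c0 V) (scale c V)].
  elim: q => [|q [c [Ic cn0 ch]]]; first by exists c0; split.
  have [h Ih nh] := next c Ic.
  have h0 : h != 0.
    by apply/eqP => h0; apply: nh; exists 0; rewrite ?mul0r //; apply: subring0.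
  exists h; split=> //; exists (scale c V); split=> //; first exact: submodule_scale.
    case: (pselect (V (h / c))) => [Vhc|/Vv].
      by exfalso; apply: nh; exists (h / c); rewrite ?divfK.
    rewrite invf_div => Vch _ [v Vvv <-]; exists (c / h * v); first exact: subringM.
    by rewrite mulrA [h * _]mulrC divfK.
  move=> sub; apply: nh; have [|v Vvv ev] := sub h.
    by exists 1; rewrite ?mulr1 //; case: hVr.
  by exists v => //; rewrite mulrC.
(* Since [b^k / c0] is in [S], the chain from [c0 V] lies between [b^k V] and [V], where lengths are
   at most [k L]. *)
have [k hk] := denominators c0^-1; have V1 : V 1 by case: hVr.
have bound := scale_pow_le S1 SB SM b0 Sb (n := k) VS
  (krull_akizuki S1 SB SM b0 Sb Slen denominators VS V1).
have [c [Ic cn0 ch]] := grow (k * L).+1.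
suff: (k * L < k * L)%N by rewrite ltnn.
apply: bound; apply: chain_mono ch.
  move=> _ [v Vvv <-]; exists (b ^+ k / c0 * v); last by rewrite mulrA [c0 * _]mulrC divfK.
  by apply: subringM => //; apply: SV.
by move=> _ [v Vvv <-]; apply: subringM => //; apply: IV.
Qed.

End Principal.

(** * Bundled subrings and algebraic residues *)

Section SubringVal.
Variables (F : fieldType) (V : subringClosed F).
Implicit Types u v : subring_type V.

Definition subring_elt (u : F) (Vu : u \in V) : subring_type V := exist _ u Vu.

Lemma val_subringM u v : val (u * v) = val u * val v. Proof. by []. Qed.
Lemma val_subringD u v : val (u + v) = val u + val v. Proof. by []. Qed.
Lemma val_subringX u n : val (u ^+ n) = val u ^+ n.
Proof. by elim: n => [|n IH]; rewrite ?expr0 // !exprS val_subringM IH. Qed.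
Lemma val_subring_sum n (f : 'I_n -> subring_type V) :
  val (\sum_i f i) = \sum_i val (f i).
Proof. by elim/big_rec2: _ => // i x y _ <-. Qed.

End SubringVal.

Lemma is_subring_closed (F : fieldType) (V0 : set F) : is_subring V0 ->
  exists V : subringClosed F, forall u, u \in V <-> V0 u.
Proof.
move=> [V1 VB VM]; pose p u := `[< V0 u >].
have pc : subring_closed p.
  by split=> [|u v /asboolP hu /asboolP hv|u v /asboolP hu /asboolP hv];
    apply/asboolP; [|apply: VB|apply: VM].
exists (HB.pack p (GRing.isSubringClosed.Build F p pc) : subringClosed F) => u.
by split=> /asboolP.
Qed.

Lemma idealr_closed_idealr (A : comNzRingType) (I : {pred A}) : idealr_closed I ->
  exists J : idealr A, J =i I.
Proof.
move=> hI; pose p u := u \in I; have pc : idealr_closed p by [].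
by exists (HB.pack p (isIdealr.Build A p pc) : idealr A).
Qed.

Section Dominating.
Variables (R : idomainType) (m : idealr R).
Variables (V : subringClosed {fraction R}) (mv : idealr (subring_type V)).
Let F : fieldType := {fraction R}.
Hypothesis dom : dominates m mv.

Definition incl (r : R) : subring_type V := subring_elt (dom.1 r).

Lemma incl_mem r : (incl r \in mv) = (r \in m).
Proof.
apply/idP/idP => [h|/dom.2 [w wm e]]; first by apply/dom.2; exists (incl r).
by have -> : incl r = w by apply: val_inj.
Qed.

Lemma pi_eq0 (w : subring_type V) : (Hv mv w = 0) <-> w \in mv.
Proof.
have <- : Hv mv 0 = 0 by rewrite /Hv rmorph0.
by rewrite -[w in w \in _]subr0 Quotient.idealrBE; split=> /eqP.
Qed.

Lemma val_horner n (c : nat -> subring_type V) (r : nat -> R) v :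
  (forall i, (i < n)%N -> val (c i) = (r i)%:F) ->
  val (\sum_(i < n) c i * v ^+ i) = ev (val v) (\poly_(i < n) r i).
Proof.
move=> cr; rewrite (ev_wide _ (size_poly _ _)) val_subring_sum; apply: eq_bigr => i _.
by rewrite val_subringM val_subringX cr // coef_poly ltn_ord.
Qed.

(** Nonzero polynomials over [K] are the reductions of primitive polynomials over [R], and a root in
    the residue field is a value in [mv]. For [V] local, the residue is thus transcendental when all
    primitive polynomials take unit values at [v], which is how [S] comes in. *)
Lemma algebraic_overP (v : subring_type V) :
  algebraic_over (residue_image mv) (Hv mv v) <->
  exists f w, [/\ primitive m f, val w = ev (val v) f & w \in mv].
Proof.
split=> [[p [pK p0 rp]]|[f [w [[i fi] ew wm]]]].
  have lift i : exists rw : R * subring_type V,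
      val rw.2 = rw.1%:F /\ Hv mv rw.2 = p`_i.
    by have [w [r er] <-] := pK i; exists (r, w).
  have [rw hrw] := choice lift.
  exists (\poly_(i < size p) (rw i).1), (\sum_(i < size p) (rw i).2 * v ^+ i); split.
  - exists (size p).-1; rewrite coef_poly prednK ?leqnn ?lt0n ?size_poly_eq0 //.
    apply: contra p0 => /dom.2 [w wm ew]; rewrite -lead_coef_eq0 lead_coefE.
    case: (hrw (size p).-1) => e <-; apply/eqP/pi_eq0.
    by have -> : (rw (size p).-1).2 = w by apply: val_inj; rewrite ew.
  - apply: (val_horner (c := fun i => (rw i).2) (r := fun i => (rw i).1)) => j _.
    by case: (hrw j).
  - apply/pi_eq0; move/eqP: rp => <-; rewrite horner_coef /Hv rmorph_sum.
    apply: eq_bigr => j _; rewrite rmorphM rmorphXn; congr (_ * _).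
    by case: (hrw j).
exists (\poly_(i < size f) Hv mv (incl f`_i)); split.
- move=> j; rewrite coef_poly; case: ifP => _.
    by exists (incl f`_j) => //; exists f`_j.
  exists (incl 0); first by exists 0.
  by apply/pi_eq0; rewrite incl_mem idealr0.
- apply/eqP => /polyP /(_ i); rewrite coef0 coef_poly; case: ltnP => [_|le].
    by move/pi_eq0; rewrite incl_mem (negPf fi).
  by rewrite nth_default // idealr0 in fi.
- apply/eqP; rewrite horner_poly.
  transitivity (Hv mv w); last exact/pi_eq0.
  have -> : w = \sum_(j < size f) incl f`_j * v ^+ j.
    apply: val_inj; rewrite ew (val_horner (c := fun j => incl f`_j) (r := fun j => f`_j)) //.
    by rewrite coefK.
  by rewrite /Hv rmorph_sum; apply: eq_bigr => j _; rewrite rmorphM rmorphXn.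
Qed.

End Dominating.

(** * Local principal ideal domains as valuation rings of rank one *)

Section DiscreteValuation.
Variables (F : fieldType) (V : subringClosed F) (mv : idealr (subring_type V)).
Add Ring Fring : (rng_theory F).
Hypotheses (hD : discrete_valuation_ring mv).
Hypothesis frac : forall u : F, exists a b : subring_type V, val b != 0 /\ u = val a / val b.

Lemma subringClosed_is_subring : is_subring [set u | u \in V].
Proof.
split=> [|u v|u v]; [exact: rpred1|exact: rpredB|exact: rpredM].
Qed.

Lemma notin_unit (v : subring_type V) : v \notin mv -> val v != 0 /\ (val v)^-1 \in V.
Proof.
move=> nv; have [_ _ hL _] := hD.
have [w e] : exists w, w * v = 1.
  apply: contrapT => nw; move/negP: nv; apply; apply: (local_mem_nonunit hL) => w e.
  by apply: nw; exists w.
have e' : val w * val v = 1 by rewrite -[RHS](congr1 val e).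
have v0 : val v != 0 by apply/eqP => v0; move/eqP: e'; rewrite v0 mulr0 eq_sym oner_eq0.
by split=> //; rewrite -[_^-1]mul1r -e' mulfK // (valP w).
Qed.

Lemma proper_ideal_gen (I : subring_type V -> Prop) : is_ideal I -> ~ I 1 ->
  exists2 g, I g & forall f, I f -> exists c, f = c * g.
Proof.
move=> hI I1; have [_ hP _ _] := hD; have [g hg] := hP _ (is_ideal_pred hI I1).
exists g.
  apply/asboolP; apply: (hg g).2.
  by exists (fun=> 1); rewrite big_ord1 mul1r.
move=> f If; have /(hg f).1 [c ->] : f \in (fun x => `[<I x>]) by apply/asboolP.
by exists (c ord0); rewrite big_ord1.
Qed.

(** Dividing numerator and denominator by a generator of the ideal they span leaves [p'] and [q']
    with [c p' + d q' = 1], one of which is a unit by locality. *)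
Lemma dvr_valuation u : u \notin V -> u^-1 \in V.
Proof.
move=> nu; have [p [q [q0 eu]]] := frac u.
pose I w := exists c d, w = c * p + d * q.
have hI : is_ideal I.
  split=> [|a _ _ [c [d ->]] [c' [d' ->]]]; first by exists 0, 0; rewrite !mul0r addr0.
  by exists (a * c + c'), (a * d + d'); rewrite mulrDr !mulrDl !mulrA addrACA.
have [p' [q' [c [d [g [e ep eq]]]]]] : exists p' q' c d g,
    [/\ c * p' + d * q' = 1, p = p' * g & q = q' * g].
  case: (pselect (I 1)) => [[c [d e]]|nI]; first by exists p, q, c, d, 1; rewrite !mulr1.
  have [g [c [d eg]] hg] := proper_ideal_gen hI nI.
  have [p' ep] : exists c, p = c * g by apply: hg; exists 1, 0; rewrite mul1r mul0r addr0.
  have [q' eq] : exists c, q = c * g by apply: hg; exists 0, 1; rewrite mul1r mul0r add0r.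
  exists p', q', c, d, g; split=> //; apply: val_inj.
  have g0 : val g != 0.
    by apply: contraNneq q0 => g0; rewrite eq val_subringM g0 mulr0.
  apply: (mulIf g0); rewrite -!val_subringM mulrDl -!mulrA -ep -eq mul1r; by rewrite -eg.
have g0 : val g != 0.
  by apply: contraNneq q0 => g0; rewrite eq val_subringM g0 mulr0.
have eu' : u = val p' / val q'.
  by rewrite eu ep eq !val_subringM invfM mulrACA divff // mulr1.
have qm : q' \in mv.
  apply: contraT => /notin_unit [_ qV]; move: nu.
  by rewrite eu' rpredM // (valP p').
have [|_ pV] := @notin_unit p'.
  apply: contraFN (idealr1 mv) => pm.
  by rewrite -e rpredD // idealMr.
by rewrite eu' invf_div rpredM // (valP q').
Qed.

(** Otherwise all [b u^n] lie in [V] and span a proper ideal. A generator [d b u^k] of it divides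
    [b u^(k+1)], which puts [u] in [V]. *)
Lemma dvr_archimedean b u : b \in V -> u \notin V -> exists n, (b * u ^+ n)^-1 \in V.
Proof.
move=> Vb nu; apply: contrapT => nn.
have Vn n : b * u ^+ n \in V.
  apply: contraT => /dvr_valuation h; exfalso; apply: nn; by exists n.
have b0 : b != 0.
  by apply/eqP => b0; apply: nn; exists 0%N; rewrite b0 mul0r invr0 rpred0.
have u0 : u != 0 by apply: contraNneq nu => ->; apply: rpred0.
have Vui := dvr_valuation nu.
(* One term is enough: the ideals spanned by the [b u^n] increase with [n], because [u^-1] is in
   [V]. *)
pose I (w : subring_type V) := exists n, exists2 d, d \in V & val w = d * (b * u ^+ n).
have hI : is_ideal I.
  split=> [|a w w' [n [d Vd e]] [k [d' Vd' e']]].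
    by exists 0%N, 0; rewrite ?mul0r // rpred0.
  exists (n + k)%N, (val a * d * u^-1 ^+ k + d' * u^-1 ^+ n).
    by rewrite rpredD // rpredM ?rpredX // rpredM // (valP a).
  rewrite val_subringD val_subringM e e' exprD.
  have h j : u^-1 ^+ j * u ^+ j = 1 by rewrite exprVn mulVf // expf_neq0.
  transitivity (val a * d * b * u ^+ n * (u^-1 ^+ k * u ^+ k)
    + d' * b * u ^+ k * (u^-1 ^+ n * u ^+ n)); last by rng F.
  have key (a1 d1 x y d2 : F) :
      a1 * (d1 * (b * x)) + d2 * (b * y) = a1 * d1 * b * x * 1 + d2 * b * y * 1.
    by rng F.
  by rewrite !h; exact: key.
have [[n [d Vd e]]|[w [k [d Vd ew]] hw]] : I 1 \/
    exists2 g, I g & forall f, I f -> exists c, f = c * g.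
- by case: (pselect (I 1)) => h; [left|right; apply: proper_ideal_gen].
- apply: nn; exists n; suff -> : (b * u ^+ n)^-1 = d by [].
  by apply: (mulIf (mulf_neq0 b0 (expf_neq0 n u0))); rewrite mulVf ?mulf_neq0 ?expf_neq0 // -e.
have [|c /(congr1 val)] := hw (subring_elt (Vn k.+1)).
  by exists k.+1, 1; rewrite ?rpred1 //= mul1r.
rewrite val_subringM ew /= exprS => e; move/negP: nu; apply.
suff -> : u = val c * d by rewrite rpredM // (valP c).
by apply: (mulIf (mulf_neq0 b0 (expf_neq0 k u0))); rewrite -mulrA -e; rng F.
Qed.

End DiscreteValuation.

(** * Dicritical divisors over a regular local ring of dimension two *)

Section RegularLocalRing.
Variables (R : idomainType) (m : idealr R).
Hypothesis hR : regular_local_ring m 2.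
Let F : fieldType := {fraction R}.
Add Ring Fring : (rng_theory F).

(** [P] is the middle term of a chain of three primes; the strict inclusions on its two sides
    provide the two elements. *)
Lemma regular_parameters : exists x y (P : {pred R}),
  [/\ x \in m, y \in m & forall r, r \in m -> exists a b, r = a * x + b * y] /\
  [/\ prime_ideal P, exists2 r, r \in m & r \notin P & exists2 r, r \in P & r != 0].
Proof.
have [hN hL [[P [Pprime Plt]] _] [s ss hs]] := hR.
case: s ss hs => [|x [|y [|]]] // _ hs.
pose i0 := Ordinal (isT : 0 < 3)%N; pose i1 := Ordinal (isT : 1 < 3)%N.
pose i2 := Ordinal (isT : 2 < 3)%N.
have strict (A B : {pred R}) : ~ {subset B <= A} -> exists2 r, r \in B & r \notin A.
  move=> h; apply: contrapT => nr; apply: h => r rB; apply: contraT => rA.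
  by exfalso; apply: nr; exists r.
have gen r : r \in m <-> exists a b, r = a * x + b * y.
  split=> [/(hs r).1 [c ->]|[a [b ->]]].
    by exists (c ord0), (c (lift ord0 ord0)); rewrite !big_ord_recl big_ord0 addr0.
  apply: (hs _).2; exists (fun i => if i == ord0 then a else b).
  by rewrite !big_ord_recl big_ord0 addr0.
exists x, y, (P i1); split.
  split=> [||r /gen//]; apply/gen.
    by exists 1, 0; rewrite mul1r mul0r addr0.
  by exists 0, 1; rewrite mul1r mul0r add0r.
split=> //.
  have [r r2 r1] := strict _ _ (Plt i1 i2 isT).2.
  exists r => //; rewrite (mem_max hL).
  have [/idealr_is_ideal h _] := Pprime i2; have [[_ P21 _] _] := Pprime i2.
  by apply: contra P21 => ur; rewrite -(mulVr ur); apply: (is_idealM _ h).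
have [r r1 r0] := strict _ _ (Plt i0 i1 isT).2.
exists r => //; apply: contraNneq r0 => ->.
by have [[]] := Pprime i0.
Qed.

Section Transcendental.
Variable z : F.
Hypotheses (nz : ~ exists r : R, z = r%:F) (nzi : ~ exists r : R, z^-1 = r%:F).
Let S := gauss_ring m z.

Lemma gauss_ring_facts : exists (b x y : R) (c L : nat),
  [/\ b \in m, b != 0, is_subring S, length_le S (scale b%:F S) S L
    & forall u, exists n, S (b%:F ^+ n * u)] /\
  [/\ forall f, primitive m f -> ev z f != 0,
      forall r, r \in m -> exists p q, r = p * x + q * y,
      S (x%:F ^+ c / b%:F) & S (y%:F ^+ c / b%:F)].
Proof.
have [hN hL _ _] := hR.
have [x [y [P [[xm ym hxy] [hP Pm P0]]]]] := regular_parameters.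
have [n [d [d0 ez]]] := fraction_num_den z.
have [g [a [b [c [p [q [p' [q' [en ed ex ey]]]]]]]]] :=
  coprime_fraction hN hL xm ym hxy n d0.
have g0 : g%:F != 0 :> F.
  by rewrite tofrac_eq0; apply: contraNneq d0; rewrite ed => ->; rewrite mulr0.
have b0 : b != 0 by apply: contraNneq d0; rewrite ed => ->; rewrite mul0r.
have {}ez : z = a%:F / b%:F.
  by rewrite ez en ed !rmorphM /= invfM mulrACA divff // mulr1.
have unit_div (r s : R) : s \notin m -> exists t : R, r%:F / s%:F = t%:F.
  rewrite (mem_max hL) negbK => us; exists (r / s).
  have s0 : s%:F != 0 :> F by rewrite tofrac_eq0; apply: contraTneq us => ->; rewrite unitr0.
  by apply: (mulIf s0); rewrite divfK // -rmorphM divrK.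
(* If [b] were a unit, [z] would be in [R]; if [a] were one, [1/z] would be. *)
have bm : b \in m.
  by apply: contraT => nb; exfalso; apply: nz; rewrite ez; apply: unit_div.
have am : a \in m.
  by apply: contraT => na; exfalso; apply: nzi; rewrite ez invf_div; apply: unit_div.
exists b, x, y, c.
rewrite /S ez.
have [L hL'] := gauss_ring_length hN hL xm ym hxy hP Pm P0 am bm b0 ex ey.
exists L; split; split=> //.
- split=> [|u v|u v].
  + by rewrite -(ev1 (a%:F / b%:F)); apply: gauss_ring_ev.
  + exact: (gauss_ringB hN hL xm ym hxy hP Pm P0 am bm b0 ex ey).
  + exact: gauss_ringM.
- exact: (gauss_ring_denominators hN hL xm ym hxy hP Pm P0 am bm b0 ex ey).
- exact: (ev_neq0 hN hL xm ym hxy hP Pm P0 am bm b0 ex ey).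
- by case: (gauss_ring_powx m b0 ex ey).
- by case: (gauss_ring_powx m b0 ex ey).
Qed.

(** Transcendence keeps the values [f(z)], [f] primitive, out of [mv]; they are units of [V], which
    therefore contains [S]. Domination puts [b] in [mv]. *)
Lemma dicritical_valuation_above b V : b \in m -> b != 0 -> dicritical_divisor m z V ->
  valuation_above S b%:F [set u | u \in V].
Proof.
move=> bm b0 [mv [[hD frac dom _] [v vz tr]]].
have ev_lift f : exists w : subring_type V, val w = ev z f.
  exists (\sum_(i < size f) incl dom f`_i * v ^+ i).
  rewrite (val_horner (c := fun i => incl dom f`_i) (r := fun i => f`_i)) //.
  by rewrite coefK vz.
have bV : b%:F \in V by exact: dom.1.
split=> [|_ [p [f [pf ->]]]||u nu|u nu].
- exact: subringClosed_is_subring.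
- have [w ew] := ev_lift p; have [w' ew'] := ev_lift f.
  have [|_ w'V] := notin_unit hD (v := w').
    apply/negP => wm; apply: tr; apply/(algebraic_overP dom).
    by exists f, w'; rewrite vz.
  by rewrite /= -ew -ew' rpredM // (valP w).
- move=> bi; have [w wm ew] := (dom.2 b).1 bm.
  have := idealr1 mv; suff -> : 1 = subring_elt bi * w by rewrite idealMr.
  by apply: val_inj; rewrite val_subringM ew /= mulVf // tofrac_eq0.
- by apply: (dvr_valuation hD frac); apply/negP.
- by apply: (dvr_archimedean hD frac bV); apply/negP.
Qed.

Lemma primitive_subXn k l : k != l -> primitive m ('X^k - 'X^l).
Proof.
move=> kl; exists k; rewrite coefB !coefXn eqxx (negPf kl) subr0.
by rewrite idealr1.
Qed.

Lemma finite_dicritical : finite_set (dicritical_divisors m z).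
Proof.
have [b [x [y [c [L [[bm b0 hS Slen den] [ev0 _ _ _]]]]]]] := gauss_ring_facts.
apply: contrapT => /infiniteP /card_leP [f].
pose g (n : nat) := f (SigSub (mem_set (I : [set: nat] n))).
have bF0 : b%:F != 0 :> F by rewrite tofrac_eq0.
have [S1 SB SM] := hS.
have Sz : S z by rewrite -(evX z); apply: gauss_ring_ev.
have Sz_unit k l : k != l -> z ^+ k - z ^+ l != 0 /\ S (z ^+ k - z ^+ l)^-1.
  move=> /primitive_subXn pf; have <- : ev z ('X^k - 'X^l) = z ^+ k - z ^+ l.
    by rewrite evB !evXn.
  by split; [apply: ev0|apply: gauss_ring_evV].
(* An infinite set would contain [L + 1] distinct dicritical divisors, all above the same [S] with
   the same [b]. *)
have := card_valuation_above (V_ := fun i => [set u | u \in val (g i)]) S1 SB SM bF0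
  (gauss_ring_frac m z b) Slen den Sz Sz_unit (n := L.+1).
rewrite ltnn => h; have : false; last by []; apply: h.
  by move=> i _; apply: dicritical_valuation_above => //; apply: (set_mem (valP (g i))).
move=> i j _ _ e; have gij : g i = g j.
  apply: val_inj; apply: subringClosed_ext => u.
  by have := congr1 (fun A : set F => A u) e; apply: is_true_inj.
have [] // : i = j.
by have := inj (in_setT _) (in_setT _) gij => -[].
Qed.

Lemma exists_dicritical : exists V, dicritical_divisors m z V.
Proof.
have [b [x [y [c [L [[bm b0 hS Slen den] [ev0 hxy Sx Sy]]]]]]] := gauss_ring_facts.
have [hN hL _ _] := hR; have [S1 SB SM] := hS.
have bF0 : b%:F != 0 :> F by rewrite tofrac_eq0.
have Sb : S b%:F := gauss_ring_frac m z b.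
(* From [1/b = p(z)/f(z)] it follows that [f - b p] vanishes at [z], although it is primitive like
   [f], as [b] is in [m]. *)
have nSb : ~ S b%:F^-1.
  move=> [p [f [[i fi] e]]]; have pr : primitive m (f - b%:P * p).
    exists i; rewrite coefB coefCM; apply: contra fi => h.
    by rewrite -(subrK (b * p`_i) f`_i) rpredD // mulrC idealMr.
  have f0 : ev z f != 0 by apply: ev0; exists i.
  have := ev0 _ pr; rewrite evB evM evC; case/negP; apply/eqP.
  have -> : ev z p = b%:F^-1 * ev z f by rewrite e divfK.
  by rewrite mulVKf // subrr.
have [V0 hV] := exists_valuation_above hS bF0 Sb nSb.
have [hVr SV nVb Vv Vr] := hV; have [V1 VB VM] := hVr.
have VR r : V0 r%:F by apply: SV; apply: gauss_ring_frac.
have [V memV] := is_subring_closed hVr.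
(* The inverse of 0 is 0, which is in [V0]; hence the separate clause. *)
pose nonunit u := u = 0 \/ ~ V0 u^-1.
(* One of [v/u] and [u/v] is in [V0], so [a u + v] is a multiple of [u] or of [v]. *)
have nonunitD a u v : V0 a -> V0 u -> V0 v -> nonunit u -> nonunit v -> nonunit (a * u + v).
  move=> Va Vu Vvv nu nv.
  have [->|w0] := eqVneq (a * u + v) 0; [by left|right=> Vw].
  have lem r s : s != 0 -> nonunit s -> V0 r -> a * u + v = r * s -> False.
    move=> s0 [/eqP|]; first by rewrite (negPf s0).
    move=> ns Vrr e; apply: ns; have -> : s^-1 = r * (a * u + v)^-1.
      rewrite e invfM mulrA mulfV ?mul1r //.
      by apply: contraNneq w0 => r0; rewrite e r0 mul0r.
    exact: VM.
  have [u0|u0] := eqVneq u 0.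
    have [v0|v0] := eqVneq v 0; first by rewrite u0 v0 mulr0 addr0 eqxx in w0.
    by apply: (lem 1 v) => //; rewrite u0 mulr0 add0r mul1r.
  case: (pselect (V0 (v / u))) => [Vvu|/Vv].
    apply: (lem (a + v / u) u) => //; first by apply: subringD.
    by rewrite mulrDl divfK.
  have [v0|v0] := eqVneq v 0.
    by move=> _; apply: (lem a u) => //; rewrite v0 addr0.
  rewrite invf_div => Vuv; apply: (lem (a * (u / v) + 1) v) => //.
    by apply: subringD => //; apply: VM.
  by rewrite mulrDl mul1r -mulrA divfK.
pose pm (w : subring_type V) := `[< nonunit (val w) >].
have Vval (w : subring_type V) : V0 (val w) by apply/memV/(valP w).
have pmc : idealr_closed pm.
  split; first by apply/asboolP; left.
    by apply/asboolP => -[/eqP|]; [rewrite oner_eq0|rewrite invr1].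
  move=> a u v /asboolP nu /asboolP nv; apply/asboolP.
  by apply: nonunitD.
have [mv mvE] := idealr_closed_idealr pmc.
have memm w : (w \in mv) <-> nonunit (val w) by rewrite mvE; split=> /asboolP.
have dom1 r : r%:F \in V by apply/memV.
pose i r := subring_elt (dom1 r).
have im r : r \in m -> i r \in mv.
  (* As [b] divides [t^c], inverting [t] in [V0] would invert [b]. *)
  have par t : S (t%:F ^+ c / b%:F) -> i t \in mv.
    move=> St; apply/memm; have [->|t0] := eqVneq (val (i t)) 0; [by left|right=> Vt].
    apply: nVb; have -> : b%:F^-1 = t%:F^-1 ^+ c * (t%:F ^+ c / b%:F).
      by rewrite exprVn mulKf // expf_neq0.
    by apply: VM; [apply: subringX|apply: SV].
  move=> /hxy [p [q ->]].
  have -> : i (p * x + q * y) = i p * i x + i q * i y.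
    by apply: val_inj; rewrite val_subringD !val_subringM /= rmorphD !rmorphM.
  by rewrite rpredD // idealMr // par.
have dom : dominates m mv.
  split=> // r; split=> [/im h|[w wm e]]; first by exists (i r).
  rewrite (mem_max hL); apply/negP => ur.
  have r0 : r%:F != 0 :> F by rewrite tofrac_eq0; apply: contraTneq ur => ->; rewrite unitr0.
  have /memm [] := wm; rewrite e; first by move/eqP; rewrite (negPf r0).
  apply; have -> : r%:F^-1 = (r^-1)%:F by apply: (mulIf r0); rewrite mulVf // -rmorphM mulVr.
  exact: VR.
have maxm : forall I : {pred subring_type V}, idealr_closed I -> {subset I <= mv}.
  move=> I [_ I1 hI] w Iw; apply/memm; apply: contrapT => nw.
  have w0 : val w != 0 by apply/eqP => e; apply: nw; left.
  have Vw : (val w)^-1 \in V by apply/memV; apply: contrapT => h; apply: nw; right.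
  move/negP: I1; apply.
  have -> : 1 = subring_elt Vw * w.
    by apply: val_inj; rewrite val_subringM /= mulVf.
  have I0 : 0 \in I by move: (hI (- 1) _ _ Iw Iw); rewrite mulN1r addNr.
  by have := hI (subring_elt Vw) _ _ Iw I0; rewrite addr0.
have hD : discrete_valuation_ring mv.
  split.
  - move=> u v /(congr1 val); rewrite val_subringM => /eqP; rewrite mulf_eq0.
    by rewrite -!(inj_eq val_inj).
  - move=> I [I0 I1 hI].
    have [|a _ _ Va [u Iu <-] [v Iv <-]|_ [u Iu <-] //|g [w Iw ew] hg] :=
      valuation_above_principal S1 SB SM bF0 Sb Slen den hV
        (I := [set u | exists2 w, w \in I & val w = u]).
    + by exists 0.
    + have Va' : a \in V by apply/memV.
      by exists (subring_elt Va' * u + v); [apply: hI|].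
    exists w => u; split=> [Iu|[d ->]].
      have [|e Ve eu] := hg (val u); first by exists u.
      have Ve' : e \in V by apply/memV.
      exists (fun=> subring_elt Ve'); rewrite big_ord1 /=.
      by apply: val_inj; rewrite val_subringM eu ew.
    by rewrite big_ord1 /=; have := hI (d ord0) _ _ Iw I0; rewrite addr0.
  - have mc : idealr_closed mv.
      by case: pmc => h0 h1 h; split=> [||a u v]; rewrite !mvE //; apply: h.
    split.
      split=> // I hI sub u; apply/idP/idP; [exact: maxm|exact: sub].
    by move=> N [hN' Nmax] u; rewrite (Nmax mv mc) //; apply: maxm.
  - exists (i b); first exact: im.
    by rewrite -(inj_eq val_inj).
have Vz : z \in V by apply/memV/SV; rewrite -(evX z); apply: gauss_ring_ev.
pose v := subring_elt Vz.
have tr : transcendental_over (residue_image mv) (Hv mv v).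
  move=> /(algebraic_overP dom) [f [w [pf ew /memm]]]; rewrite ew => -[/eqP|].
    by rewrite (negPf (ev0 _ pf)).
  by apply; apply: SV; apply: gauss_ring_evV.
exists V, mv; split; last by exists v.
split=> //; last by exists (Hv mv v).
move=> u; have [n [d [d0 ->]]] := fraction_num_den u.
by exists (i n), (i d); rewrite /= tofrac_eq0.
Qed.

End Transcendental.
End RegularLocalRing.

(** Modulo [m], [f] becomes a nonzero polynomial over [K] with the residue of [z] as a root. *)
Lemma no_dicritical_of_root (R : idomainType) (m : idealr R) (z : {fraction R}) f :
  primitive m f -> ev z f = 0 -> dicritical_divisors m z = set0.
Proof.
move=> pf fz; rewrite predeqE => V; split=> // -[mv [[_ _ dom _] [v vz tr]]].
apply: tr; apply/(algebraic_overP dom); exists f, 0.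
by rewrite vz fz idealr0.
Qed.

Theorem proposition1p2 (R : idomainType) (m : idealr R)
    (hR : regular_local_ring m 2) (z : {fraction R}) (hz : z != 0) :
  finite_set (dicritical_divisors m z) /\
  (dicritical_divisors m z = set0 <->
     (exists r : R, z = r%:F) \/ (exists r : R, z^-1 = r%:F)).
Proof.
have none : (exists r : R, z = r%:F) \/ (exists r : R, z^-1 = r%:F) ->
    dicritical_divisors m z = set0.
  (* [z] is a root of [X - r] or of [r X - 1], which are primitive for every [r] because of a
     coefficient 1 or -1. *)
  case=> -[r er].
    apply: (@no_dicritical_of_root _ _ _ ('X - r%:P)).
      by exists 1%N; rewrite coefB coefX coefC subr0 idealr1.
    by rewrite evB evX evC er subrr.
  apply: (@no_dicritical_of_root _ _ _ (r%:P * 'X - 1)).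
    exists 0%N; rewrite coefB coefMX coef1 sub0r /=.
    by rewrite rpredN idealr1.
  by rewrite evB evM evC evX ev1 -er mulVf // subrr.
case: (pselect ((exists r : R, z = r%:F) \/ (exists r : R, z^-1 = r%:F))) => [h|nh].
  by rewrite none //; split=> //; exact: finite_set0.
have nz : ~ exists r : R, z = r%:F by move=> h; apply: nh; left.
have nzi : ~ exists r : R, z^-1 = r%:F by move=> h; apply: nh; right.
split; first exact: finite_dicritical.
split=> [e|/none //]; have [V] := exists_dicritical hR nz nzi.
by rewrite e.
Qed.
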